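(* Let $1\le p<\infty$ and let $\varepsilon_0>0$ be sufficiently small. Then there exists a constant $C>0$ such that for all $\varepsilon\in(0,\varepsilon_0)$ and all $v\in W^{1,p}(D_\varepsilon;\omega^\varepsilon)$ $$\int_{D_\varepsilon}|v|^p\,|\nabla\omega^\varepsilon|\,dx\le C\,\|v\|^p_{W^{1,p}(D_\varepsilon;\omega^\varepsilon)}.$$
   Context: $D\subset\mathbb{R}^n$ is a bounded domain with boundary of class $C^{1,1}$. $d_D(x)=\mathrm{dist}(x,D)-\mathrm{dist}(x,\mathbb{R}^n\setminus D)$; $D_t=\{x: d_D(x)<t\}$. $S:\mathbb{R}\to\mathbb{R}$ is a fixed function satisfying: (S1) $S$ is Lipschitz, $S(t)=t/|t|$ for $|t|\ge1$, $S'(t)>0$ for $|t|<1$, and $S(-t)=-S(t)$; (S2) there are $\zeta_1,\zeta_2,\alpha>0$ with $\zeta_1t^\alpha\le(1+S(t-1))/2\le\zeta_2t^\alpha$ for all $t\in(0,2)$. Put $\omega^\varepsilon(x)=\frac12\bigl(1+S(-d_D(x)/\varepsilon)\bigr)$, so $D_\varepsilon=\{\omega^\varepsilon>0\}$. $W^{1,p}(D_\varepsilon;\omega^\varepsilon)$ is the space of functions $v$ on $D_\varepsilon$ with $v$ and its weak first partial derivatives in $L^p(D_\varepsilon;\omega^\varepsilon)=\{v:\int_{D_\varepsilon}|v|^p\omega^\varepsilon dx<\infty\}$, normed by $\|v\|^p_{W^{1,p}(D_\varepsilon;\omega^\varepsilon)}=\int_{D_\varepsilon}(|v|^p+|\nabla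 v|^p)\omega^\varepsilon dx$. *)

(* Defs.v *)
From HB Require Import structures.
From mathcomp Require Import all_boot all_order all_algebra.
From mathcomp Require Import all_classical all_reals all_analysis.

Set Implicit Arguments.
Unset Strict Implicit.
Unset Printing Implicit Defensive.

Import Order.TTheory GRing.Theory Num.Theory.
Import numFieldNormedType.Exports.

Local Open Scope classical_set_scope.
Local Open Scope ring_scope.

(** R^n is ['rV[R]_n]. Its topology is the library's (the one of the sup norm);
  the Euclidean norm is [enorm] below. The sigma-algebra is the product one,
  generated by the coordinates, i.e. the Borel sigma-algebra; as with the
  library's [lebesgue_measure] on [R], the measure is not completed. *)

Definition rV_display : measure_display -> measure_display.
Proof. exact. Qed.

Section rV_measurable.
Context {R : realType} (n : nat).

Let coord (i : 'I_n) (x : 'rV[R]_n) : R := x ord0 i.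

Let rV_set0 : g_sigma_preimage coord set0.
Proof. exact: sigma_algebra0. Qed.

Let rV_setC A : g_sigma_preimage coord A -> g_sigma_preimage coord (~` A).
Proof. exact: sigma_algebraC. Qed.

Let rV_bigcup (F : (set 'rV[R]_n)^nat) :
  (forall i, g_sigma_preimage coord (F i)) ->
  g_sigma_preimage coord (\bigcup_i F i).
Proof. exact: sigma_algebra_bigcup. Qed.

HB.instance Definition _ :=
  @isMeasurable.Build (rV_display default_measure_display) 'rV[R]_n
    (g_sigma_preimage coord) rV_set0 rV_setC rV_bigcup.

Lemma measurable_coord (i : 'I_n) :
  measurable_fun [set: 'rV[R]_n] (fun x => x ord0 i).
Proof.
move=> _ Y mY; rewrite setTI; apply: sub_sigma_algebra => /=.
rewrite -bigcup_seq/=; exists i => /=; first by rewrite mem_index_enum.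
by exists Y => //; rewrite setTI.
Qed.

Lemma measurable_fun_rV d (T : measurableType d) (f : T -> 'rV[R]_n) :
  (forall i, measurable_fun [set: T] (fun t => f t ord0 i)) ->
  measurable_fun [set: T] f.
Proof.
move=> mf _ A mA; rewrite setTI.
suff: (g_sigma_preimage coord `<=` [set B | measurable (f @^-1` B)]) by exact.
apply: smallest_sub.
  split => /= [|B|F].
  - by rewrite preimage_set0.
  - by rewrite setTD preimage_setC; exact: measurableC.
  - by rewrite preimage_bigcup => mF; exact: bigcup_measurable.
rewrite -bigcup_seq => B [i /= _ [C mC <-]]; rewrite setTI /=.
by have := mf i measurableT C mC; rewrite setTI.
Qed.

End rV_measurable.

Section cons_rV.
Context {R : realType} (n : nat).

Definition cons_rV (z : R * 'rV[R]_n) : 'rV[R]_n.+1 :=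
  row_mx (const_mx z.1 : 'rV_1) z.2.

Definition uncons_rV (x : 'rV[R]_n.+1) : R * 'rV[R]_n :=
  (x ord0 ord0, \row_i x ord0 (lift ord0 i)).

Lemma cons_rV0 z : cons_rV z ord0 ord0 = z.1.
Proof.
have -> : ord0 = lshift n (ord0 : 'I_1) :> 'I_(1 + n) by exact/val_inj.
by apply: etrans (row_mxEl _ _ _ _) _; rewrite mxE.
Qed.

Lemma cons_rVS z i : cons_rV z ord0 (lift ord0 i) = z.2 ord0 i.
Proof.
have -> : lift ord0 i = rshift 1 i :> 'I_(1 + n) by exact/val_inj.
exact: row_mxEr.
Qed.

Lemma cons_rVK : cancel cons_rV uncons_rV.
Proof.
move=> z; rewrite /uncons_rV cons_rV0 [RHS]surjective_pairing; congr pair.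
by apply/rowP => i; rewrite mxE cons_rVS.
Qed.

Lemma uncons_rVK : cancel uncons_rV cons_rV.
Proof.
move=> x; apply/rowP => i; have [j ->|->] := unliftP ord0 i.
- by rewrite cons_rVS mxE.
- by rewrite cons_rV0.
Qed.

Lemma measurable_cons_rV : measurable_fun [set: R * 'rV[R]_n] cons_rV.
Proof.
apply: measurable_fun_rV => i; have [j ->|->] := unliftP ord0 i.
- apply: (eq_measurable_fun (fun z : R * 'rV[R]_n => z.2 ord0 j)).
    by move=> z _; rewrite cons_rVS.
  exact (measurableT_comp (measurable_coord (j : 'I_n)) measurable_snd).
- apply: (eq_measurable_fun (fun z : R * 'rV[R]_n => z.1)); last exact: measurable_fst.
  by move=> z _; rewrite cons_rV0.
Qed.

Lemma measurable_uncons_rV : measurable_fun [set: 'rV[R]_n.+1] uncons_rV.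
Proof.
apply: measurable_fun_pair; first exact: measurable_coord.
apply: measurable_fun_rV => i.
apply: (eq_measurable_fun (fun x : 'rV[R]_n.+1 => x ord0 (lift ord0 i))).
  by move=> x _; rewrite mxE.
exact: measurable_coord.
Qed.

End cons_rV.

Section lebesgue_rV_step.
Context {R : realType} (n : nat).
Variable m : {sigma_finite_measure set 'rV[R]_n -> \bar R}.
Local Open Scope ereal_scope.

Definition lebesgue_rV_step : set 'rV[R]_n.+1 -> \bar R :=
  pushforward (@lebesgue_measure R \x m) (@cons_rV R n).

Let mcons A : measurable A -> measurable (@cons_rV R n @^-1` A).
Proof.
by move=> mA; rewrite -[X in measurable X]setTI; exact: measurable_cons_rV.
Qed.

Let step0 : lebesgue_rV_step set0 = 0.
Proof. by rewrite /lebesgue_rV_step /pushforward preimage_set0 measure0. Qed.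

Let step_ge0 A : 0 <= lebesgue_rV_step A.
Proof. by rewrite /lebesgue_rV_step /pushforward measure_ge0. Qed.

Let step_sigma_additive : semi_sigma_additive lebesgue_rV_step.
Proof.
move=> F mF tF mUF; rewrite /lebesgue_rV_step /pushforward preimage_bigcup.
apply: measure_semi_sigma_additive.
- by move=> i; exact: mcons.
- apply/trivIsetP => /= i j _ _ ij; rewrite -preimage_setI.
  by move/trivIsetP : tF => /(_ _ _ _ _ ij) ->//; rewrite preimage_set0.
- by rewrite -preimage_bigcup; exact: mcons.
Qed.

HB.instance Definition _ := isMeasure.Build _ _ _
  lebesgue_rV_step step0 step_ge0 step_sigma_additive.

Let step_sigma_finite : sigma_finite setT lebesgue_rV_step.
Proof.
have /sigma_finiteP[F [TF ndF Foo]] := sigma_finiteT (@lebesgue_measure R).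
have /sigma_finiteP[G [TG ndG Goo]] := sigma_finiteT m.
exists (fun i => @uncons_rV R n @^-1` (F i `*` G i)).
  rewrite -preimage_bigcup (_ : \bigcup_i (F i `*` G i) = setT)//.
  rewrite -setXTT TF TG; apply/seteqP; split => -[x y] /=.
    by move=> [i _ []/= ? ?]; split; exists i.
  move=> [/= [i _ Fix] [k _ Gky]]; exists (maxn i k) => //; split.
  - by move: x Fix; exact/subsetPset/ndF/leq_maxl.
  - by move: y Gky; exact/subsetPset/ndG/leq_maxr.
move=> i; have [mF Fi] := Foo i; have [mG Gi] := Goo i; split.
  by rewrite -[X in measurable X]setTI; apply: measurable_uncons_rV => //;
     exact: measurableX.
rewrite /lebesgue_rV_step /pushforward -comp_preimage.
rewrite (_ : _ \o _ = id); last by apply/funext => z /=; rewrite cons_rVK.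
by rewrite preimage_id product_measure1E// lte_mul_pinfty// ge0_fin_numE.
Qed.

HB.instance Definition _ := Measure_isSigmaFinite.Build _ _ _
  lebesgue_rV_step step_sigma_finite.

End lebesgue_rV_step.

(** [lebesgue_rV n.+1] is the product of the Lebesgue measure on the line with
  [lebesgue_rV n], transported along R * R^n -> R^(n+1). *)
Fixpoint lebesgue_rV (R : realType) (n : nat) :
    {sigma_finite_measure set 'rV[R]_n -> \bar R} :=
  match n with
  | 0 => \d_(0 : 'rV[R]_0)
  | k.+1 => lebesgue_rV_step (lebesgue_rV R k)
  end.

Lemma lebesgue_rV_box (R : realType) (n : nat) (A : 'I_n -> set R) :
  (forall i, measurable (A i)) ->
  lebesgue_rV R n [set x | forall i, A i (x ord0 i)] =
  (\prod_(i < n) @lebesgue_measure R (A i))%E.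
Proof.
elim: n A => [|n IHn] A mA.
  by rewrite big_ord0 /= diracE mem_set//= => -[].
rewrite big_ord_recl -(IHn (fun i => A (lift ord0 i)))//.
pose B : set 'rV[R]_n := [set x | forall i : 'I_n, A (lift ord0 i) (x ord0 i)].
have mB : measurable B.
  rewrite (_ : B =
      \bigcap_(i in setT) ((fun x : 'rV[R]_n => x ord0 i) @^-1` A (lift ord0 i))).
    apply: fin_bigcap_measurable => [|i _]; first exact: finite_finset.
    by rewrite -[X in measurable X]setTI; exact: measurable_coord.
  by apply/seteqP; split => [x Bx i _|x Bx i]; exact: Bx.
rewrite [LHS](_ : _ = (@lebesgue_measure R \x lebesgue_rV R n)%E (A ord0 `*` B)).
  by rewrite product_measure1E//; exact: mA.
rewrite /= /lebesgue_rV_step /pushforward; congr (_ _).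
apply/seteqP; split => z /= Az.
- split; first by have := Az ord0; rewrite cons_rV0.
  by move=> i; have := Az (lift ord0 i); rewrite cons_rVS.
- move=> i; have [j ->|->] := unliftP ord0 i; last by rewrite cons_rV0; exact: Az.1.
  by rewrite cons_rVS; exact: Az.2.
Qed.

Section calculus.
Context {R : realType} {n : nat}.
Implicit Types (x y : 'rV[R]_n) (f : 'rV[R]_n -> R) (A : set 'rV[R]_n).

Definition enorm x : R := Num.sqrt (\sum_(i < n) x ord0 i ^+ 2).

Definition partial (i : 'I_n) f : 'rV[R]_n -> R := 'D_(delta_mx ord0 i) f.

(** Where a partial derivative does not exist, ['D_v f] takes a junk value;
  [gradient] is only used for Lipschitz functions, for which this happens on a
  null set. *)
Definition gradient f : 'rV[R]_n -> 'rV[R]_n := fun x => \row_i partial i f x.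

Fixpoint class_C (k : nat) f : Prop :=
  continuous f /\
  match k with
  | 0 => True
  | j.+1 => forall i, (forall x, derivable f x (delta_mx ord0 i)) /\
                      class_C j (partial i f)
  end.

Definition smooth f : Prop := forall k, class_C k f.

Definition class_C11 f : Prop :=
  (forall x, differentiable f x) /\ forall i, lipschitz (partial i f).

Definition dist x A : R := inf [set enorm (x - y) | y in A].

Definition signed_dist A x : R := dist x A - dist x (~` A).

End calculus.

Section domains.
Context {R : realType} {n : nat}.
Implicit Types D : set 'rV[R]_n.

Definition bounded_domain D : Prop :=
  [/\ D !=set0, open D, connected D & bounded_set D].

Definition sublevel D (t : R) : set 'rV[R]_n := [set x | signed_dist D x < t].

End domains.

(** Near each boundary point, after an orthogonal change of coordinates [Q],
  D is the strict epigraph of a C^{1,1} function of the first n coordinates.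
  Since only a neighbourhood of the point matters, [gamma] may be taken to be
  defined, with Lipschitz gradient, on all of R^n. *)
Definition C11_boundary (R : realType) (n : nat) (D : set 'rV[R]_n.+1) : Prop :=
  forall x0, (closure D `\` interior D) x0 ->
  exists (r : R) (Q : 'M[R]_n.+1) (gamma : 'rV[R]_n -> R),
    [/\ 0 < r, Q *m Q^T = 1%:M, class_C11 gamma &
      forall x, enorm (x - x0) < r ->
        (D x <-> gamma (col' ord_max (x *m Q)) < (x *m Q) ord0 ord_max)].

Section phase_field.
Context {R : realType}.

Definition transition_profile (S : R -> R) : Prop :=
  [/\ lipschitz S,
      forall t, 1 <= `|t| -> S t = t / `|t|,
      forall t, `|t| < 1 -> derivable S t 1 /\ 0 < derive1 S t &
      forall t, S (- t) = - S t].

Definition power_growth (S : R -> R) : Prop :=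
  exists zeta1 zeta2 alpha : R,
    [/\ 0 < zeta1, 0 < zeta2, 0 < alpha &
      forall t, 0 < t < 2 ->
        zeta1 * t `^ alpha <= (1 + S (t - 1)) / 2 <= zeta2 * t `^ alpha].

Definition phase_field (S : R -> R) (n : nat) (D : set 'rV[R]_n) (eps : R)
    (x : 'rV[R]_n) : R :=
  (1 + S (- signed_dist D x / eps)) / 2.

End phase_field.

Section sobolev.
Context {R : realType} {n : nat}.
Implicit Types (U : set 'rV[R]_n) (v w : 'rV[R]_n -> R)
  (g : 'rV[R]_n -> 'rV[R]_n) (p : R).

Definition locally_integrable_on U v : Prop :=
  measurable_fun U v /\
  forall K, compact K -> K `<=` U ->
    (\int[lebesgue_rV R n]_(x in K) `|v x|%:E < +oo)%E.

Definition test_function U (phi : 'rV[R]_n -> R) : Prop :=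
  [/\ smooth phi,
      compact (closure [set x | phi x != 0]) &
      closure [set x | phi x != 0] `<=` U].

Definition is_weak_gradient U v g : Prop :=
  [/\ locally_integrable_on U v,
      forall i, locally_integrable_on U (fun x => g x ord0 i) &
      forall i phi, test_function U phi ->
        (\int[lebesgue_rV R n]_(x in U) (v x * partial i phi x)%:E =
         - \int[lebesgue_rV R n]_(x in U) (g x ord0 i * phi x)%:E)%E].

(** The weak gradient is unique up to a null set; [weak_gradient] selects a
  representative when there is one. *)
Definition weak_gradient U v : 'rV[R]_n -> 'rV[R]_n :=
  xget (fun=> 0) [set g | is_weak_gradient U v g].

Definition weighted_Lp p U w : set ('rV[R]_n -> R) :=
  [set v : 'rV[R]_n -> R | measurable_fun U v /\
    (\int[lebesgue_rV R n]_(x in U) (`|v x| `^ p * w x)%:E < +oo)%E].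

Definition weighted_W1p p U w : set ('rV[R]_n -> R) :=
  [set v : 'rV[R]_n -> R | [/\ exists g, is_weak_gradient U v g,
      weighted_Lp p U w v &
      forall i, weighted_Lp p U w (fun x => weak_gradient U v x ord0 i)]].

(** The p-th power of the norm of W^{1,p}(U; w). *)
Definition weighted_W1p_normp p U w v : \bar R :=
  (\int[lebesgue_rV R n]_(x in U)
     ((`|v x| `^ p + enorm (weak_gradient U v x) `^ p) * w x)%:E)%E.

End sobolev.

(* Main.v *)
(** Since D is locally a strict C^1 epigraph, near each boundary point some
  coordinate direction e = +-e_i points into D uniformly: the signed distance d
  satisfies d(x + t e) <= d(x) - c t.  Hence w = omega^eps increases along e and,
  where |d| < eps, |grad w(x)| is at most a constant, independent of eps, times
  the difference quotient (w(x) - w(x - t e)) / t for small t; where d <= -eps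
  the gradient vanishes.  So only A phi (w(x) - w(x - t e)) / t has to be
  integrated, with A = |v|^p and phi a cut-off around the boundary point.  By
  translation invariance the difference falls on A phi.  As phi is Lipschitz and
  w increases along e, the convexity of |.|^p and the identity
  v(x + t e) - v(x) = int_0^t d_e v(x + r e) dr, valid for almost all x, bound the
  integral by C int (|v|^p + |d_e v|^p) w, uniformly in t; let t tend to 0 by Fatou's
  lemma and sum over a finite cover of the boundary. *)
Require Import Defs.
From HB Require Import structures.
From mathcomp Require Import all_boot all_order all_algebra.
From mathcomp Require Import all_classical all_reals all_analysis.
From mathcomp Require Import measurable_realfun ring lra.

Set Implicit Arguments.
Unset Strict Implicit.
Unset Printing Implicit Defensive.

Import Order.TTheory GRing.Theory Num.Theory.
Import numFieldNormedType.Exports.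

Local Open Scope classical_set_scope.
Local Open Scope ring_scope.

(** The constant is independent of eps because one factor cancels. With q = S'(-d/eps), |grad w| is
    at most a multiple of q/eps, while (w(x) - w(x - t e))/t is, for small t, at least a multiple of
    q/eps. No lower bound on q is available, but only the ratio of the two multiples survives, and
    the cone alone fixes it. The distance d is merely Lipschitz, so only its increments are
    compared. Measurability of |grad w| is never established: the integrand is dominated by a
    measurable lower limit of difference quotients, and the integral of a nonnegative function, a
    supremum over simple functions below it, is monotone anyway. Coordinate directions replace
    normals so that a single weak partial derivative of v and products of one-variable functions
    suffice. The identity for v(x + t e) - v(x) comes from testing the weak gradient with a bump
    averaged along a segment: its partial derivative is exactly a finite difference of the bump.
    Smallness of eps serves only to keep the layer |d| < eps inside the finitely many charts. *)

(* No measurability is assumed: this applies to |v|^p |grad omega^eps|. *)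
Lemma le_lower_integral d (T : measurableType d) (R : realType)
    (mu : {measure set T -> \bar R}) (D : set T) (f g : T -> \bar R) :
  (forall x, D x -> (0 <= f x)%E) -> (forall x, D x -> (f x <= g x)%E) ->
  (\int[mu]_(x in D) f x <= \int[mu]_(x in D) g x)%E.
Proof.
move=> f0 fg; rewrite !ge0_integralE//; last first.
  by move=> x Dx; exact: le_trans (f0 _ Dx) (fg _ Dx).
apply: ge_ereal_sup => _ [h /= hf <-]; apply: ereal_sup_ubound; exists h => //=.
by move=> x; apply: le_trans (hf x) _; apply: lee_restrict.
Qed.

(** * Boxes and translations *)

Section boxes.
Context {R : realType} {n : nat}.
Implicit Types (a b x : 'rV[R]_n) (A : set 'rV[R]_n).

Definition obox a b : set 'rV[R]_n :=
  [set x | forall i, a ord0 i < x ord0 i < b ord0 i].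
Definition cbox a b : set 'rV[R]_n :=
  [set x | forall i, a ord0 i <= x ord0 i <= b ord0 i].

Lemma sub_obox_cbox a b : obox a b `<=` cbox a b.
Proof. by move=> x abx i; have /andP[/ltW -> /ltW ->] := abx i. Qed.

Lemma measurable_box (B : 'I_n -> set R) : (forall i, measurable (B i)) ->
  measurable [set x : 'rV[R]_n | forall i, B i (x ord0 i)].
Proof.
move=> mB; rewrite (_ : mkset _ =
    \bigcap_(i in setT) ((fun x : 'rV[R]_n => x ord0 i) @^-1` B i)).
  apply: fin_bigcap_measurable => [|i _]; first exact: finite_finset.
  by rewrite -[X in measurable X]setTI; apply: (measurable_coord i) => //.
by apply/seteqP; split => [x Bx i _|x Bx i]; exact: Bx.
Qed.

Lemma oboxE a b :
  obox a b = [set x : 'rV[R]_n | forall i, `]a ord0 i, b ord0 i[%classic (x ord0 i)].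
Proof.
by apply/seteqP; split => x /= abx i; have := abx i; rewrite /= in_itv.
Qed.

Lemma cboxE a b :
  cbox a b = [set x : 'rV[R]_n | forall i, `[a ord0 i, b ord0 i]%classic (x ord0 i)].
Proof.
by apply/seteqP; split => x /= abx i; have := abx i; rewrite /= in_itv.
Qed.

Lemma measurable_obox a b : measurable (obox a b).
Proof.
rewrite oboxE.
exact: (measurable_box (B := fun i => `]a ord0 i, b ord0 i[%classic)).
Qed.

Lemma compact_cbox a b : compact (cbox a b).
Proof.
rewrite cboxE; apply: (@rV_compact _ _ (fun i => `[a ord0 i, b ord0 i]%classic)).
by move=> i; exact: segment_compact.
Qed.

Lemma oboxI a b a' b' : obox a b `&` obox a' b' =
  obox (\row_i Num.max (a ord0 i) (a' ord0 i))
       (\row_i Num.min (b ord0 i) (b' ord0 i)).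
Proof.
apply/seteqP; split => [x [abx abx'] i|x abx].
  rewrite !mxE gt_max lt_min.
  by have /andP[-> ->] := abx i; have /andP[-> ->] := abx' i.
split => i; have := abx i; rewrite !mxE gt_max lt_min.
  by case/andP => /andP[-> _] /andP[-> _].
by case/andP => /andP[_ ->] /andP[_ ->].
Qed.

Lemma obox_setI_closed : setI_closed [set A | exists a b, A = obox a b].
Proof.
by move=> _ _ [a [b ->]] [a' [b' ->]]; rewrite oboxI; eexists; eexists.
Qed.

Definition rat_obox (q : 'rV[rat]_n * 'rV[rat]_n) :=
  obox (map_mx ratr q.1) (map_mx ratr q.2).
Definition rat_cbox (q : 'rV[rat]_n * 'rV[rat]_n) :=
  cbox (map_mx ratr q.1) (map_mx ratr q.2).

(** Rational endpoints close to each coordinate of x give a box around x inside [A], and make the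
    union countable. Asking that even the closed box lie in [A] provides compact boxes, on which
    local integrability can be used. *)
Lemma open_bigcup_obox A : open A ->
  A = \bigcup_(q in [set q | rat_cbox q `<=` A]) rat_obox q.
Proof.
move=> oA; apply/seteqP; split=> [x Ax|x [q qA] /sub_obox_cbox]; last exact: qA.
have /nbhs_ballP[e /= e0 eA] : nbhs x A by exact: open_nbhs_nbhs.
have /choice[a ha] (i : 'I_n) :
    exists q : rat, ratr q \in `](x ord0 i - e), (x ord0 i)[.
  by apply: rat_in_itvoo; rewrite ltrBlDr ltrDl.
have /choice[b hb] (i : 'I_n) :
    exists q : rat, ratr q \in `](x ord0 i), (x ord0 i + e)[.
  by apply: rat_in_itvoo; rewrite ltrDl.
exists (\row_i a i, \row_i b i) => [|i] /=; last first.
  rewrite !mxE; have := ha i; have := hb i.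
  by rewrite !in_itv/= => /andP[-> _] /andP[_ ->].
move=> y aby; apply: eA; split => // i j; rewrite ord1 /ball /=.
have := aby j; rewrite !mxE => /andP[ay yb].
have := ha j; have := hb j; rewrite !in_itv/= => /andP[_ bx] /andP[ax _].
by rewrite ltr_distl; apply/andP; split; lra.
Qed.

Lemma measurable_bigcup_rat_obox (P : set ('rV[rat]_n * 'rV[rat]_n)) :
  <<s [set A | exists a b, A = obox a b] >> (\bigcup_(q in P) rat_obox q).
Proof.
rewrite bigcup_mkcond.
apply: (@countable_bigcupT_measurable _
  (g_sigma_algebraType [set A | exists a b, A = obox a b])) => //.
move=> q; case: ifP => _; last exact: measurable0.
by apply: sub_sigma_algebra; exists (map_mx ratr q.1), (map_mx ratr q.2).
Qed.

(** The boxes form a generating pi-system, as needed for uniqueness of measures and for Dynkin's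
    argument. For the generation, the preimage of an open interval under a coordinate is open, hence
    a countable union of rational boxes. *)
Lemma measurable_oboxE :
  @measurable _ 'rV[R]_n = <<s [set A | exists a b, A = obox a b] >>.
Proof.
apply/seteqP; split; last first.
  apply: smallest_sub; first exact: sigma_algebra_measurable.
  by move=> _ [a [b ->]]; exact: measurable_obox.
apply: smallest_sub; first exact: smallest_sigma_algebra.
rewrite -bigcup_seq => _ [i /= _ [C mC <-]].
pose T := g_sigma_algebraType [set A | exists a b, A = obox a b].
have : measurable_fun [set: T] ((fun x : 'rV[R]_n => x ord0 i) : T -> R).
  apply: (measurability _ (RGenOpens.measurableE R)) => _ [_ [a [b ->] <-]].
  rewrite setTI (open_bigcup_obox (_ : open ((fun x => x ord0 i) @^-1` `]a, b[)))//.
    exact: measurable_bigcup_rat_obox.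
  by apply: open_comp => [x _|]; [exact: coord_continuous|exact: interval_open].
by move=> /(_ measurableT C mC).
Qed.

Lemma open_measurable_rV A : open A -> measurable A.
Proof.
by move=> /open_bigcup_obox ->; rewrite measurable_oboxE;
  exact: measurable_bigcup_rat_obox.
Qed.

Lemma continuous_measurable_rV (f : 'rV[R]_n -> R) :
  continuous f -> measurable_fun [set: 'rV[R]_n] f.
Proof.
move=> cf; apply: (measurability _ (RGenOpens.measurableE R)).
move=> _ [_ [a [b ->] <-]]; rewrite setTI; apply: open_measurable_rV.
by apply: open_comp => [x _|]; [exact: cf|exact: interval_open].
Qed.

Lemma measurable_translation (a : 'rV[R]_n) :
  measurable_fun [set: 'rV[R]_n] (fun x => x + a).
Proof.
apply: measurable_fun_rV => i.
apply: (eq_measurable_fun (fun x : 'rV[R]_n => x ord0 i + a ord0 i)).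
  by move=> x _; rewrite mxE.
by apply: measurable_funD => //; exact: measurable_coord.
Qed.

Lemma norm_coord_le x i : `|x ord0 i| <= `|x|.
Proof.
by rewrite [leRHS]/Num.norm /= mx_normrE;
  exact: (le_bigmax _ (fun ij => `|x ij.1 ij.2|) (ord0, i)).
Qed.

Lemma lebesgue_rV_obox a b :
  lebesgue_rV R n (obox a b) =
  (\prod_(i < n) @lebesgue_measure R `]a ord0 i, b ord0 i[%classic)%E.
Proof.
rewrite oboxE.
exact: (lebesgue_rV_box (A := fun i => `]a ord0 i, b ord0 i[%classic)).
Qed.

Lemma lebesgue_rV_obox_lty a b : (lebesgue_rV R n (obox a b) < +oo)%E.
Proof.
rewrite lebesgue_rV_obox.
suff : (\prod_(i < n) @lebesgue_measure R `]a ord0 i, b ord0 i[%classic)%E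
    \is a fin_num by rewrite fin_numE => /andP[_]; rewrite ltey.
elim/big_ind : _ => // [x y|i _]; first exact: fin_numM.
by rewrite lebesgue_measure_itv /=; case: ifP.
Qed.

(** Uniqueness of measures: both sides agree on boxes, by the one-dimensional lengths, and the cubes
    centred at 0 exhaust the space with finite measure. *)
Lemma lebesgue_rV_translation a A : measurable A ->
  pushforward (lebesgue_rV R n) (fun x => x + a) A = lebesgue_rV R n A.
Proof.
move=> mA.
pose mphi := isMeasurableFun.Build _ _ _ _ _ (measurable_translation a).
pose phi : {mfun _ >-> _} := HB.pack (fun x : 'rV[R]_n => x + a) mphi.
apply/esym; apply: (@measure_unique _ _ _ [set A | exists a b, A = obox a b]
  (fun k => obox (const_mx (- k%:R)) (const_mx k%:R)) _ _ _ _ _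
  (pushforward (lebesgue_rV R n) phi)) => //.
- exact: measurable_oboxE.
- exact: obox_setI_closed.
- by move=> k; eexists; eexists.
- apply/seteqP; split=> // x _ /=; exists (Num.bound `|x|) => // i.
  rewrite !mxE -ltr_norml; apply: le_lt_trans (archi_boundP (normr_ge0 x)).
  exact: norm_coord_le.
- move=> _ [u [v ->]]; rewrite /= /pushforward.
  rewrite (_ : _ @^-1` _ = obox (u - a) (v - a)); last first.
    by apply/seteqP; split => x xuv i; have := xuv i; rewrite /= !mxE ltrBlDr ltrBrDr.
  rewrite !lebesgue_rV_obox; apply: eq_bigr => i _.
  rewrite !lebesgue_measure_itv/= !lte_fin !mxE ltrD2r; case: ifP => // _.
  by rewrite -!EFinB; congr (_%:E); ring.
- by move=> k; exact: lebesgue_rV_obox_lty.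
Qed.

End boxes.

Section translation_and_boxes.
Context {R : realType} {n : nat}.
Local Notation mu := (lebesgue_rV R n).
Implicit Types (a b x : 'rV[R]_n).

Lemma ge0_integral_translation a (f : 'rV[R]_n -> \bar R) :
  measurable_fun setT f -> (forall x, 0 <= f x)%E ->
  (\int[mu]_x f (x + a)%R = \int[mu]_x f x)%E.
Proof.
move=> mf f0; pose mphi := isMeasurableFun.Build _ _ _ _ _ (measurable_translation a).
pose phi : {mfun _ >-> _} := HB.pack (fun x : 'rV[R]_n => x + a) mphi.
transitivity (\int[pushforward mu phi]_x f x)%E.
  by rewrite (ge0_integral_pushforward (measurable_translation a)).
by apply: eq_measure_integral => A mA _; exact: lebesgue_rV_translation.
Qed.

Lemma integral_translation a (f : 'rV[R]_n -> \bar R) :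
  measurable_fun setT f ->
  (\int[mu]_x f (x + a)%R = \int[mu]_x f x)%E.
Proof.
move=> mf; rewrite integralE [RHS]integralE.
rewrite -(ge0_integral_translation a (f := f^\+%E))//; last exact: measurable_funepos.
rewrite -(ge0_integral_translation a (f := f^\-%E))//;
  last exact: measurable_funeneg.
by congr (_ - _)%E; apply: eq_integral => x _; rewrite ?funeposE ?funenegE.
Qed.

(** The sets over which [h] integrates to 0 form a Dynkin system containing the boxes. The vanishing
    of the integral over all of [D] is what makes this system stable under complements. *)
Lemma ae_eq0_of_obox (D : set 'rV[R]_n) (h : 'rV[R]_n -> \bar R) :
  measurable D -> mu.-integrable D h ->
  (\int[mu]_(x in D) h x = 0)%E ->
  (forall a b, \int[mu]_(x in D `&` obox a b) h x = 0)%E ->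
  ae_eq mu D h (cst 0%E).
Proof.
move=> mD ih h0 hbox.
suff H A : measurable A -> (\int[mu]_(x in D `&` A) h x = 0)%E.
  apply: integral_ae_eq => // E ED mE.
  by rewrite integral0 -(setIidr ED); exact: H.
move=> mA; have : <<s [set A | exists a b : 'rV[R]_n, A = obox a b] >> A.
  by rewrite -measurable_oboxE.
move: A {mA}; apply: dynkin_induction.
- exact: measurable_oboxE.
- exact: obox_setI_closed.
- by rewrite setIT.
- by move=> _ [a [b ->]].
- move=> A mA hA; have := h0.
  rewrite -{1}(setUIDK D A) integral_setU ?hA ?add0e -?setDE//.
  + exact: measurableI.
  + exact: measurableD.
  + by rewrite setUIDK; exact: measurable_int ih.
  + by apply/disj_set2P; rewrite setDE setIACA setICr setI0.
- move=> F mF tF hF; rewrite setI_bigcupr integral_bigcup.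
  + by apply: eseries0 => k _ _; exact: hF.
  + exact: trivIset_setIl.
  + by move=> k; exact: measurableI.
  + apply: integrableS ih => //; first by apply: bigcupT_measurable => k; exact: measurableI.
    by apply: bigcup_sub => k _; exact: subIsetl.
Qed.

End translation_and_boxes.

(** * Smooth bump functions *)

Section smooth_functions_of_one_variable.
Context {R : realType}.
Implicit Types (f g : R -> R) (x y : R) (k : nat).

(** The class C^k on the line, with the derivative as an existential witness, so that the closure
    properties below can exhibit explicit formulas. *)
Fixpoint C1d k f : Prop :=
  match k with
  | 0 => continuous f
  | j.+1 => exists2 f', forall x, is_derive x 1 f (f' x) & C1d j f'
  end.

Lemma is_derive_continuous f f' : (forall x, is_derive x 1 f (f' x)) ->
  continuous f.
Proof.
by move=> df x; apply/differentiable_continuous/derivable1_diffP; case: (df x).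
Qed.

Lemma C1d_continuous k f : C1d k f -> continuous f.
Proof. by case: k => //= k [f' df _]; exact: is_derive_continuous df. Qed.

Lemma C1dW k f : C1d k.+1 f -> C1d k f.
Proof.
elim: k f => [|k IHk] f; first exact: C1d_continuous.
by case=> f' df Cf'; exists f' => //; exact: IHk.
Qed.

Lemma C1dD k f g : C1d k f -> C1d k g -> C1d k (f \+ g).
Proof.
elim: k f g => [|k IHk] f g /=; first by move=> cf cg x; apply: cvgD; [exact: cf|exact: cg].
case=> f' df Cf [g' dg Cg]; exists (f' \+ g'); last exact: IHk.
by move=> x; exact: is_deriveD.
Qed.

Lemma C1d_cst k c : C1d k (cst c).
Proof.
elim: k c => [|k IHk] c /=; first by move=> x; exact: cvg_cst.
by exists (cst 0) => // x; exact: is_derive_cst.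
Qed.

Lemma C1dM k f g : C1d k f -> C1d k g -> C1d k (f \* g).
Proof.
elim: k f g => [|k IHk] f g; first by move=> cf cg x; apply: cvgM; [exact: cf|exact: cg].
move=> Cf Cg; have Cf' := C1dW Cf; have Cg' := C1dW Cg.
case: Cf => f' df Cf; case: Cg => g' dg Cg.
exists ((f \* g') \+ (g \* f')); last by apply: C1dD; exact: IHk.
by move=> x; exact: is_deriveM.
Qed.

Lemma is_derive_affine a b x : is_derive x 1 (fun x => a * x + b) a.
Proof.
rewrite (_ : (fun _ => _) = cst a * id + cst b)//; apply: is_derive_eq.
by rewrite /GRing.scale/= mulr1 mulr0 !addr0.
Qed.

Lemma C1d_affine k f a b : C1d k f -> C1d k (fun x => f (a * x + b)).
Proof.
elim: k f => [|k IHk] f /=.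
  move=> cf x; apply: continuous_comp; last exact: cf.
  by apply: cvgD; [apply: cvgM; [exact: cvg_cst|exact: cvg_id]|exact: cvg_cst].
case=> f' df Cf; exists ((fun x => f' (a * x + b)) \* cst a); last first.
  by apply: C1dM; [exact: IHk|exact: C1d_cst].
move=> x /=; apply: (is_derive1_comp (f := f) (g := fun x => a * x + b)).
exact: is_derive_affine.
Qed.

(* The functions x^-k exp(-1/x) on x > 0 are stable under differentiation up to
   linear combinations, hence smooth. *)
Definition bump_germ k x : R := if 0 < x then x^-1 ^+ k * expR (- x^-1) else 0.

Lemma bump_germ_ge0 k x : 0 <= bump_germ k x.
Proof.
rewrite /bump_germ; case: ifP => // x0.
by rewrite mulr_ge0 ?expR_ge0// exprn_ge0// invr_ge0 ltW.
Qed.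

(** With y = 1/x this is y^(k+2) <= (k+2)! exp y, a single term of the exponential series. A bound
    of order x^2 is what makes the difference quotient at 0 tend to 0. *)
Lemma bump_germ_le k x : bump_germ k x <= k.+2`!%:R * x ^+ 2.
Proof.
rewrite /bump_germ; case: ifP => [x0|_]; last by rewrite mulr_ge0// sqr_ge0.
set y := x^-1; have y0 : 0 < y by rewrite invr_gt0.
have -> : x = y^-1 by rewrite invrK.
move: y y0 => y y0 {x x0}.
have := expR_ge1Dxn k.+1 (ltW y0).
rewrite expRN ler_pdivrMr ?expR_gt0// => h.
have {}h : y ^+ k.+2 <= k.+2`!%:R * expR y.
  rewrite mulrC -ler_pdivrMr ?ltr0n ?fact_gt0//.
  by apply: le_trans h; rewrite lerDr.
rewrite exprVn mulrAC ler_pdivlMr ?exprn_gt0//.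
by rewrite -exprD addn2.
Qed.

Lemma is_derive_bump_germ k x : is_derive x 1 (bump_germ k)
  (bump_germ k.+2 x - k%:R * bump_germ k.+1 x).
Proof.
have [x0|x0|<-{x}] := ltgtP 0 x.
- apply: (@near_eq_is_derive _ _ _ (fun x => x^-1 ^+ k * expR (- x^-1))).
    near=> y; rewrite /bump_germ ifT//; near: y.
    exact: lt_nbhsr.
  rewrite /bump_germ x0.
  have x0' : x != 0 by rewrite gt_eqF.
  have dV : is_derive x 1 (fun y => y^-1) (- x ^- 2).
    by have := is_deriveV x0' (is_derive_id x 1); rewrite /GRing.scale/= mulr1.
  have dE : is_derive x 1 (fun y => expR (- y^-1)) (x ^- 2 * expR (- x^-1)).
    rewrite mulrC; apply: (is_derive1_comp (f := expR) (g := fun y => - y^-1)).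
    by have := is_deriveN dV; rewrite opprK.
  have D := is_deriveM (is_deriveX k dV) dE.
  rewrite (_ : (fun _ => _) =
    (fun y => y^-1) ^+ k * (fun y => expR (- y^-1))); last first.
    by apply/funext => y; rewrite !fctE.
  apply: is_derive_eq D _; rewrite /GRing.scale/= !fctE -exprVn.
  by case: k => [|k]; rewrite ?exprS/=; ring.
- apply: (@near_eq_is_derive _ _ _ (cst 0)).
    near=> y; rewrite /bump_germ ltNge ifF//; apply/negbF; near: y.
    by apply: filterS (lt_nbhsl x0) => z /ltW.
  rewrite /bump_germ ltNge ltW//= mulr0 subr0; exact: is_derive_cst.
- rewrite /bump_germ ltxx mulr0 subr0.
  suff dk : (fun h => h^-1 *: ((bump_germ k \o shift 0) (h *: 1) - bump_germ k 0)) h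
     @[h --> 0^'] --> 0.
    by apply: DeriveDef; [exact: cvgP dk|exact: cvg_lim dk].
  have M0 : 0 < k.+2`!%:R :> R by rewrite ltr0n fact_gt0.
  apply/cvgr0Pnorm_le => e e0; near=> h.
  have h0 : h != 0 by near: h; exact: nbhs_dnbhs_neq.
  have hb : bump_germ k 0 = 0 by rewrite /bump_germ ltxx.
  rewrite /= hb subr0 addr0 /GRing.scale/= mulr1 normrM normfV.
  rewrite ler_pdivrMl ?normr_gt0// ger0_norm ?bump_germ_ge0//.
  apply: le_trans (bump_germ_le k h) _.
  rewrite -real_normK ?num_real// expr2 mulrCA ler_wpM2l// mulrC -ler_pdivlMr//.
  by near: h; apply: dnbhs0_le; rewrite divr_gt0.
Unshelve. all: by end_near. Qed.

End smooth_functions_of_one_variable.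

Section bumps.
Context {R : realType}.
Implicit Types (f : R -> R) (a b x y : R) (k m : nat).
Local Notation mu := (@lebesgue_measure R).

Lemma bump_germ_C1d j k : C1d j (@bump_germ R k).
Proof.
elim: j k => [|j IHj] k /=.
  exact: is_derive_continuous (is_derive_bump_germ k).
eexists; first exact: is_derive_bump_germ.
have -> : (fun x => bump_germ k.+2 x - k%:R * bump_germ k.+1 x) =
    bump_germ k.+2 \+ (cst (- k%:R) \* bump_germ k.+1).
  by apply/funext => x /=; rewrite mulNr.
by apply: C1dD => //; apply: C1dM => //; exact: C1d_cst.
Qed.

(** On ]a, b[ this is exp(-((x - a)^-1 + (b - x)^-1) / (m + 1)), and 0 elsewhere: smooth, with
    values in [0, 1], and convergent to the indicator of ]a, b[ as m grows. *)
Definition bump a b m x : R :=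
  bump_germ 0 (m.+1%:R * (x - a)) * bump_germ 0 (m.+1%:R * (b - x)).

Lemma bump_C1d j a b m : C1d j (bump a b m).
Proof.
have -> : bump a b m = (fun x => bump_germ 0 (m.+1%:R * x + - (m.+1%:R * a))) \*
    (fun x => bump_germ 0 (- m.+1%:R * x + m.+1%:R * b)).
  by apply/funext => x; rewrite /bump/=; congr (bump_germ _ _ * bump_germ _ _); ring.
by apply: C1dM; apply: C1d_affine; exact: bump_germ_C1d.
Qed.

Lemma bump_germ0_le1 x : bump_germ 0 x <= 1.
Proof.
rewrite /bump_germ; case: ifP => // x0; rewrite mul1r expR_le1 oppr_le0.
by rewrite invr_ge0 ltW.
Qed.

Lemma bump_ge0 a b m x : 0 <= bump a b m x.
Proof. by rewrite mulr_ge0// bump_germ_ge0. Qed.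

Lemma bump_le1 a b m x : bump a b m x <= 1.
Proof. by rewrite mulr_ile1// ?bump_germ_ge0// bump_germ0_le1. Qed.

Lemma bump_out a b m x : ~~ (a < x < b) -> bump a b m x = 0.
Proof.
rewrite negb_and -!leNgt /bump /bump_germ => /orP[xa|bx].
  by rewrite pmulr_rgt0// subr_gt0 ltNge xa mul0r.
have -> : (0 < m.+1%:R * (b - x)) = false.
  by rewrite pmulr_rgt0// subr_gt0 ltNge bx.
by rewrite mulr0.
Qed.

Lemma cvg_bump a b x : a < x < b -> bump a b m x @[m --> \oo] --> (1 : R).
Proof.
move=> /andP[ax xb].
have cvg_factor c : 0 < c -> bump_germ 0 (m.+1%:R * c) @[m --> \oo] --> (1 : R).
  move=> c0; rewrite (_ : (fun _ => _) = (fun m : nat => expR (- (c^-1 * m.+1%:R^-1)))).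
    rewrite -[X in _ --> X]expR0 -oppr0 -(mulr0 c^-1).
    apply: continuous_cvg; first exact: continuous_expR.
    apply: cvgN; apply: cvgM; first exact: cvg_cst.
    exact: cvg_harmonic.
  apply/funext => m; rewrite /bump_germ pmulr_lgt0// ltr0Sn mul1r.
  by rewrite invfM mulrC.
rewrite -[X in _ --> X](mulr1 1); apply: cvgM; apply: cvg_factor;
  by rewrite subr_gt0.
Qed.

(** Since [f] vanishes to the left of [a], integrating from [a - 1] gives an antiderivative on the
    whole line: it is locally 0 before [a], and the fundamental theorem applies from [a] on. *)
Lemma continuous_antiderivative f a : continuous f -> (forall x, x <= a -> f x = 0) ->
  exists F, forall x, is_derive x 1 F (f x).
Proof.
move=> cf fa; exists (fun x => \int[mu]_(t in `[a - 1, x]) f t)%R => x.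
have [xa|ax] := ltP x a; last first.
  have fi : mu.-integrable `[a - 1, x + 1] (EFin \o f).
    apply: continuous_compact_integrable; first exact: segment_compact.
    exact: continuous_subspaceT.
  have xx1 : x < x + 1 by rewrite ltrDl.
  have ax1 : a - 1 < x by lra.
  have [dF <-] := continuous_FTC1_closed xx1 fi ax1 (cf x).
  by rewrite derive1E; exact: derivableP.
rewrite fa ?ltW//; apply: near_eq_is_derive (is_derive_cst (0 : R) x 1).
near=> y; rewrite /Rintegral integral0_eq//= => t /=; rewrite in_itv/= => /andP[_ ty].
rewrite fa//; apply: le_trans ty _; near: y.
by apply: filterS (lt_nbhsl xa) => z /ltW.
Unshelve. all: by end_near. Qed.

(** For s = 1 or -1 the derivative in y is the finite difference s (f y - f (y - s t)). Used as one
    factor of a test function, it turns the definition of the weak derivative into a statement about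
    translates. *)
Definition shift_avg f (s t : R) y : R := \int[mu]_(r in `[0, t]) f (y - s * r).

(** If F is an antiderivative of [f], then r |-> -s F(z - s r) is one of f(z - s r) because s^2 = 1.
    Hence the average equals s (F z - F (z - s t)), which is differentiated directly. *)
Lemma is_derive_shift_avg f a s t y : continuous f ->
  (forall x, x <= a -> f x = 0) -> s ^+ 2 = 1 -> 0 < t ->
  is_derive y 1 (shift_avg f s t) (s * (f y - f (y - s * t))).
Proof.
move=> cf fa s1 t0; have [F dF] := continuous_antiderivative cf fa.
have E (z : R) : shift_avg f s t z = s * (F z - F (z - s * t)).
  rewrite /shift_avg /Rintegral.
  have dG (r : R) : is_derive r 1 (fun r => - s * F (- s * r + z)) (f (z - s * r)).
    have := is_deriveZ (- s) (is_derive1_comp (dF _) (is_derive_affine (- s) z r)).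
    rewrite /GRing.scale/= mulrCA mulrNN -expr2 s1 mulr1 (addrC _ z) mulNr.
    exact.
  rewrite (@continuous_FTC2 R _ (fun r => - s * F (- s * r + z)) 0 t)//.
  - by rewrite -EFinB/= mulr0 add0r (addrC _ z) !mulNr; ring.
  - apply: continuous_subspaceT => r; apply: continuous_comp; last exact: cf.
    by apply: cvgB; [exact: cvg_cst|apply: cvgM; [exact: cvg_cst|exact: cvg_id]].
  - have cG := is_derive_continuous dG.
    split => [r _||]; first by case: (dG r).
    + by apply: cvg_at_right_filter; exact: cG.
    + by apply: cvg_at_left_filter; exact: cG.
  - by move=> r _; rewrite derive1E; case: (dG r).
rewrite (_ : shift_avg f s t = fun z => s *: (F z - F (1 * z + - (s * t)))); last first.
  by apply/funext => z; rewrite E mul1r.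
apply: is_deriveZ; apply: is_deriveB.
have := is_derive1_comp (dF _) (is_derive_affine 1 (- (s * t)) y).
by rewrite mulr1 mul1r.
Qed.

Lemma shift_avg_C1d j f a s t : C1d j f ->
  (forall x, x <= a -> f x = 0) -> s ^+ 2 = 1 -> 0 < t ->
  C1d j (shift_avg f s t).
Proof.
move=> Cf fa s1 t0; have cf := C1d_continuous Cf; apply: C1dW.
eexists => [x|]; first exact: (is_derive_shift_avg x cf fa s1 t0).
rewrite (_ : (fun _ => _) = cst s \* (f \+ (cst (- 1) \* (fun x => f (1 * x + - (s * t)))))).
  apply: C1dM; first exact: C1d_cst.
  by apply: C1dD => //; apply: C1dM; [exact: C1d_cst|exact: C1d_affine].
by apply/funext => x /=; rewrite mul1r mulN1r.
Qed.

End bumps.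

(** * Tensor products of one-variable functions as test functions on R^n *)

Section product_test_functions.
Context {R : realType} {n : nat}.
Implicit Types (F G : 'rV[R]_n -> R) (x v : 'rV[R]_n) (i : 'I_n) (k : nat).

(** Implies [class_C], but carries the partial derivatives as witnesses, which makes stability under
    sums and products a plain induction. *)
Fixpoint CNd k F : Prop :=
  continuous F /\
  match k with
  | 0 => True
  | j.+1 => forall i, exists2 F',
      forall x, is_derive x (delta_mx ord0 i) F (F' x) & CNd j F'
  end.

Lemma CNd_class_C k F : CNd k F -> class_C k F.
Proof.
elim: k F => [|k IHk] F [cF] //= CF; split => // i.
have [F' dF CF'] := CF i; split; first by move=> x; case: (dF x).
by rewrite (_ : partial i F = F'); [exact: IHk|apply/funext => x; case: (dF x)].
Qed.

Lemma CNd_continuous k F : CNd k F -> continuous F.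
Proof. by case: k => [|k] []. Qed.

Lemma CNdW k F : CNd k.+1 F -> CNd k F.
Proof.
elim: k F => [|k IHk] F; first by move=> [cF _]; split.
by move=> [cF CF]; split=> // i; have [F' dF /IHk CF'] := CF i; exists F'.
Qed.

Lemma CNdD k F G : CNd k F -> CNd k G -> CNd k (F \+ G).
Proof.
elim: k F G => [|k IHk] F G [cF CF] [cG CG]; split=> //;
  try by move=> x; exact: (cvgD (cF x) (cG x)).
move=> i; have [F' dF CF'] := CF i; have [G' dG CG'] := CG i.
by exists (F' \+ G'); [move=> x; exact: is_deriveD|exact: IHk].
Qed.

Lemma CNd_cst k c : CNd k (cst c).
Proof.
elim: k c => [|k IHk] c; split=> //; try exact: cst_continuous.
by move=> i; exists (cst 0) => // x; exact: is_derive_cst.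
Qed.

Lemma CNdM k F G : CNd k F -> CNd k G -> CNd k (F \* G).
Proof.
elim: k F G => [|k IHk] F G CF CG; have cF := CNd_continuous CF;
  have cG := CNd_continuous CG; split=> //;
  try by move=> x; exact: (cvgM (cF x) (cG x)).
move=> i; have [F' dF CF'] := CF.2 i; have [G' dG CG'] := CG.2 i.
exists ((F \* G') \+ (G \* F')); first by move=> x; exact: is_deriveM.
by apply: CNdD; apply: IHk => //; exact: CNdW.
Qed.

Lemma is_derive_invariant G x v : (forall h : R, G (h *: v + x) = G x) ->
  is_derive x v G 0.
Proof.
move=> Gv.
have q0 : (fun h : R => h^-1 *: ((G \o shift x) (h *: v) - G x)) h @[h --> 0^'] --> (0 : R).
  rewrite (_ : (fun h => _) = cst 0); first exact: cvg_cst.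
  by apply/funext => h; rewrite /= Gv subrr scaler0.
by apply: DeriveDef; [exact: cvgP q0|exact: cvg_lim q0].
Qed.

Lemma is_derive_coord (f : R -> R) x i d : is_derive (x ord0 i) 1 f d ->
  is_derive x (delta_mx ord0 i) (fun x => f (x ord0 i)) d.
Proof.
have E : (fun h : R => h^-1 *: (((fun x => f (x ord0 i)) \o shift x) (h *: delta_mx ord0 i)
       - f (x ord0 i))) =
     (fun h => h^-1 *: ((f \o shift (x ord0 i)) (h *: 1) - f (x ord0 i))).
  by apply/funext => h /=; rewrite !mxE !eqxx.
by case=> df dE; apply: DeriveDef; rewrite /derivable /derive E.
Qed.

Lemma CNd_coord k (f : R -> R) i : C1d k f -> CNd k (fun x => f (x ord0 i)).
Proof.
elim: k f => [|k IHk] f Cf; have cf := C1d_continuous Cf; split=> //;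
  try by move=> x; apply: continuous_comp; [exact: coord_continuous|exact: cf].
case: Cf => f' df Cf' j; have [<-{j}|ij] := eqVneq i j.
  exists (fun x => f' (x ord0 i)); last exact: IHk.
  by move=> x; exact: is_derive_coord.
exists (cst 0); last exact: CNd_cst.
move=> x; apply: is_derive_invariant => h.
by rewrite !mxE (negbTE ij) andbF mulr0 add0r.
Qed.

Lemma CNd_prod k (f : 'I_n -> R -> R) (r : seq 'I_n) :
  (forall i, C1d k (f i)) -> CNd k (fun x => \prod_(i <- r) f i (x ord0 i)).
Proof.
move=> Cf; elim: r => [|i r IHr].
  rewrite (_ : (fun _ => _) = cst 1); first exact: CNd_cst.
  by apply/funext => x; rewrite big_nil.
rewrite (_ : (fun _ => _) =
    (fun x => f i (x ord0 i)) \* (fun x => \prod_(i <- r) f i (x ord0 i))).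
  by apply: CNdM => //; exact: CNd_coord.
by apply/funext => x; rewrite big_cons.
Qed.

Definition tensor (f : 'I_n -> R -> R) x := \prod_(i < n) f i (x ord0 i).

Lemma smooth_tensor (f : 'I_n -> R -> R) :
  (forall i k, C1d k (f i)) -> smooth (tensor f).
Proof. by move=> Cf k; apply: CNd_class_C; exact: CNd_prod. Qed.

Lemma partial_tensor (f : 'I_n -> R -> R) i x d : is_derive (x ord0 i) 1 (f i) d ->
  partial i (tensor f) x = d * \prod_(j < n | j != i) f j (x ord0 j).
Proof.
move=> df; rewrite (_ : tensor f = (fun x => f i (x ord0 i)) *
    (fun x => \prod_(j < n | j != i) f j (x ord0 j))); last first.
  by apply/funext => y; rewrite /tensor (bigD1 i).
have dG : is_derive x (delta_mx ord0 i)
    (fun x => \prod_(j < n | j != i) f j (x ord0 j)) 0.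
  apply: is_derive_invariant => h; apply: eq_bigr => j ji.
  by rewrite !mxE (negbTE ji) andbF mulr0 add0r.
have [_] := is_deriveM (is_derive_coord df) dG; rewrite /partial => ->.
by rewrite scaler0 add0r mulrC.
Qed.

Lemma closure_support_sub F (K : set 'rV[R]_n) : compact K ->
  (forall x, F x != 0 -> K x) ->
  closure [set x | F x != 0] `<=` K /\ compact (closure [set x | F x != 0]).
Proof.
move=> cK FK; have clK : closed K.
  by apply: compact_closed => //; exact: norm_hausdorff.
have sub : closure [set x | F x != 0] `<=` K.
  by rewrite [X in _ `<=` X](closure_id K).1//; exact: closure_subset.
by split=> //; apply: subclosed_compact sub => //; exact: closed_closure.
Qed.

End product_test_functions.

(** * Translates of weakly differentiable functions *)

Section translation_fubini.
Context {R : realType} {n : nat}.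
Local Notation mu := (lebesgue_rV R n).
Local Notation leb := (@lebesgue_measure R).
Variables (e : 'rV[R]_n) (s t : R).
Local Notation I := (`[0%R, t]%classic : set R).

Lemma measurable_translate : measurable_fun [set: R * 'rV[R]_n]
  (fun z => z.2 + (s * z.1) *: e).
Proof.
apply: measurable_fun_rV => i.
apply: (eq_measurable_fun (fun z : R * 'rV[R]_n => z.2 ord0 i + (s * z.1) * e ord0 i)).
  by move=> z _; rewrite !mxE.
apply: measurable_funD.
  exact: (measurableT_comp (measurable_coord i) measurable_snd).
by apply: measurable_funM => //; apply: measurable_funM.
Qed.

(** The indicator of [0, t] extends the integrand to the whole product R * R^n, the domain on which
    Fubini's theorem is applied. *)
Definition segment_graph (G : 'rV[R]_n -> R) (z : R * 'rV[R]_n) : \bar R :=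
  (\1_I z.1 * G (z.2 + (s * z.1) *: e))%:E.

Lemma measurable_segment_graph G : measurable_fun setT G ->
  measurable_fun setT (segment_graph G).
Proof.
move=> mG; apply/measurable_EFinP; apply: measurable_funM.
  by apply: measurableT_comp => //; exact: measurable_indic.
by apply: measurableT_comp => //; exact: measurable_translate.
Qed.

Lemma integral_segment_graph G x :
  (\int[leb]_r segment_graph G (r, x) =
   \int[leb]_(r in I) (G (x + (s * r) *: e))%:E)%E.
Proof.
rewrite [RHS]integral_mkcond; apply: eq_integral => r _.
rewrite /segment_graph/= indicE patchE; case: ifP => _.
  by rewrite mul1r.
by rewrite mul0r.
Qed.

(** By translation invariance each slice at fixed r in [0, t] has the L^1 norm of [G], so the double
    integral is the length of the segment times that norm. *)
Lemma integrable_segment_graph G : mu.-integrable setT (EFin \o G) ->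
  (leb \x mu)%E.-integrable setT (segment_graph G).
Proof.
move=> iG; have mG : measurable_fun setT G.
  by apply/measurable_EFinP; exact: measurable_int iG.
apply/integrable12ltyP; first exact: measurable_segment_graph.
under eq_integral => r _.
  have -> : (\int[mu]_x `|segment_graph G (r, x)| =
     (\1_I r : R)%:E * \int[mu]_x `|(G x)%:E|)%E.
    have mabsG : measurable_fun setT (fun x => `|(G x)%:E|)%E.
      by apply/measurable_EFinP; exact: measurableT_comp.
    rewrite -(ge0_integral_translation ((s * r) *: e) mabsG) //.
    rewrite -ge0_integralZl_EFin//.
      apply: eq_integral => x _; rewrite /segment_graph/= -EFinM normrM ger0_norm//.
    by apply: (measurableT_comp mabsG); exact: measurable_translation.
  over.
rewrite ge0_integralZr//; last 2 first.
- by apply/measurable_EFinP; exact: measurable_indic.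
- by apply: integral_ge0.
have -> : (\int[leb]_r (\1_I r)%:E = leb I)%E by rewrite integral_indic// setIT.
rewrite lte_mul_pinfty//; last by case/integrableP : iG.
by rewrite lebesgue_measure_itv/=; case: ifP.
Qed.


End translation_fubini.

Section translation_fubini_test.
Context {R : realType} {n : nat}.
Local Notation mu := (lebesgue_rV R n).
Local Notation leb := (@lebesgue_measure R).
Variables (e : 'rV[R]_n) (s t : R).
Local Notation I := (`[0%R, t]%classic : set R).
Local Notation sgraph := (segment_graph e s t).

Variables (G : 'rV[R]_n -> R) (phi : 'rV[R]_n -> R).
Hypothesis iG : mu.-integrable setT (EFin \o G).
Hypothesis mphi : measurable_fun setT phi.
Hypothesis phi01 : forall x, 0 <= phi x <= 1.

Definition segment_avg x : R := \int[leb]_(r in I) phi (x - (s * r) *: e).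

Let mG : measurable_fun setT G.
Proof. by apply/measurable_EFinP; exact: measurable_int iG. Qed.

Let bphi : [bounded phi x | x in setT].
Proof.
exists 1; split => // M M1 x _ /=; have /andP[p0 p1] := phi01 x.
by rewrite ger0_norm// (le_trans p1)// ltW.
Qed.

Let iphiseg : (leb \x mu)%E.-integrable setT
  (fun z => (phi z.2)%:E * sgraph G z)%E.
Proof.
apply: (integrableMr measurableT (_ : measurable_fun setT (fun z => phi z.2))).
- exact: (measurableT_comp mphi measurable_snd).
- exists 1; split => // M M1 x _ /=; have /andP[p0 p1] := phi01 x.2.
  by rewrite ger0_norm// (le_trans p1)// ltW.
- exact: integrable_segment_graph.
Qed.

(** Forward averaging of [G] and backward averaging of [phi] are adjoint: exchange the integrals,
    translate in x at fixed r, and exchange back. *)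
Lemma integral_segment_avg :
  (\int[mu]_x ((phi x)%:E * \int[leb]_(r in I) (G (x + (s * r) *: e))%:E)
   = \int[mu]_x (G x * segment_avg x)%:E)%E.
Proof.
transitivity (\int[mu]_x \int[leb]_r ((phi x)%:E * sgraph G (r, x)))%E.
  (* Only an almost everywhere equality is available: [phi x] leaves the inner integral at those x
     where the slice of the graph is integrable. *)
  apply: ae_eq_integral => //.
  - apply: emeasurable_funM; first exact/measurable_EFinP.
    rewrite (_ : (fun _ => _) = fun x => \int[leb]_r sgraph G (r, x))%E.
      exact: measurable_fubini_G (integrable_segment_graph e s t iG).
    by apply/funext => x; rewrite integral_segment_graph.
  - exact: measurable_fubini_G iphiseg.
  - have := ae_integrable2 (integrable_segment_graph e s t iG).
    apply: filterS => x ix _ /=.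
    by rewrite integralZl// integral_segment_graph.
rewrite -(Fubini iphiseg).
transitivity (\int[leb]_r \int[mu]_x
    (\1_I r * (phi (x - (s * r) *: e) * G x))%:E)%E.
  apply: eq_integral => r _.
  rewrite -[RHS](integral_translation ((s * r) *: e)).
    by apply: eq_integral => x _; rewrite /segment_graph/= addrK -EFinM; congr _%:E; ring.
  apply/measurable_EFinP; apply: measurable_funM => //; apply: measurable_funM => //.
  by apply: (measurableT_comp mphi); exact: measurable_translation.
have iseg2 : (leb \x mu)%E.-integrable setT
    (fun z => (\1_I z.1 * (phi (z.2 - (s * z.1) *: e) * G z.2))%:E)%E.
  (* With [s := 0] the segment graph is 1_[0,t](r) G(x), so its integrability is an instance of the
     lemma already proved; the remaining factor is bounded. *)
  rewrite (_ : (fun _ => _) = (EFin \o (fun z => phi (z.2 - (s * z.1) *: e))) \*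
      segment_graph e 0 t G)%E; last first.
    apply/funext => z /=; rewrite /segment_graph mul0r scale0r addr0 -EFinM.
    by congr _%:E; ring.
  apply: (integrableMr measurableT).
  - apply: (measurableT_comp mphi).
    apply: (eq_measurable_fun (fun z : R * 'rV[R]_n => z.2 + (- s * z.1) *: e)).
      by move=> z _; rewrite mulNr scaleNr.
    exact: measurable_translate.
  - exists 1; split => // M M1 x _ /=.
    have /andP[p0 p1] := phi01 (x.2 - (s * x.1) *: e).
    by rewrite ger0_norm// (le_trans p1)// ltW.
  - exact: integrable_segment_graph.
rewrite (Fubini iseg2); apply: eq_integral => x _.
have iphi : leb.-integrable I (fun r => (phi (x - (s * r) *: e))%:E).
  apply: (@measurable_bounded_integrable _ _ _ leb (fun r => phi (x - (s * r) *: e))).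
  - exact: measurable_itv.
  - have lI : (leb I < +oo)%E by rewrite lebesgue_measure_itv/=; case: ifP; rewrite ?ltry.
    exact: lI.
  - apply: measurable_funTS; apply: (measurableT_comp mphi).
    apply: measurable_fun_rV => i.
    apply: (eq_measurable_fun (fun r => x ord0 i - (s * r) * e ord0 i)).
      by move=> r _; rewrite !mxE.
    by apply: measurable_funB => //; apply: measurable_funM => //; apply: measurable_funM.
  - exists 1; split => // M M1 r _ /=.
    have /andP[p0 p1] := phi01 (x - (s * r) *: e).
    by rewrite ger0_norm// (le_trans p1)// ltW.
rewrite /segment_avg EFinM /Rintegral fineK; last exact: integrable_fin_num.
rewrite -integralZl// [RHS]integral_mkcond; apply: eq_integral => r _.
rewrite patchE indicE; case: ifP => _; last by rewrite mul0r.
by rewrite mul1r EFinM muleC.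
Qed.


(** The error in the fundamental theorem of calculus for V along the segment from x to x + s t e,
    with [G] as the derivative. It is extended-real because the inner integral is controlled only
    for almost all x. *)
Definition translation_defect (V : 'rV[R]_n -> R) x : \bar R :=
  ((V (x + (s * t) *: e) - V x)%:E -
   s%:E * \int[leb]_(r in I) (G (x + (s * r) *: e))%:E)%E.

Lemma integrable_translation (V : 'rV[R]_n -> R) a :
  mu.-integrable setT (EFin \o V) ->
  mu.-integrable setT (fun x => (V (x + a))%:E).
Proof.
move=> iV; have mV : measurable_fun setT V.
  by apply/measurable_EFinP; exact: measurable_int iV.
apply/integrableP; split.
  apply/measurable_EFinP; apply: (measurableT_comp mV).
  exact: measurable_translation.
rewrite (ge0_integral_translation a (f := fun x => `|(V x)%:E|%E))//.
  by case/integrableP : iV.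
by apply/measurable_EFinP; exact: measurableT_comp.
Qed.

Lemma integrable_segment_integral : mu.-integrable setT
  (fun x => \int[leb]_(r in I) (G (x + (s * r) *: e))%:E)%E.
Proof.
rewrite (_ : (fun _ => _) = fun x => \int[leb]_r sgraph G (r, x))%E.
  have iS := integrable_segment_graph e s t iG; have mS := measurable_int _ iS.
  apply/integrableP; split; first exact: measurable_fubini_G iS.
  apply: le_lt_trans ((integrable21ltyP _ _ mS).1 iS).
  have mabsS : measurable_fun setT (abse \o sgraph G).
    by apply: measurableT_comp.
  apply: ge0_le_integral => //.
  - by apply: measurableT_comp => //; exact: measurable_fubini_G iS.
  - by have := measurable_fun_fubini_tonelli_G (m1 := leb) _ mabsS (fun z => abse_ge0 _).
  - move=> x _; apply: le_abse_integral => //.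
    by apply: (measurableT_comp mS).
by apply/funext => x; rewrite integral_segment_graph.
Qed.

Lemma integrable_translation_defect (V : 'rV[R]_n -> R) :
  mu.-integrable setT (EFin \o V) ->
  mu.-integrable setT (translation_defect V).
Proof.
move=> iV; apply: integrableB => //; last first.
  by apply: integrableZl => //; exact: integrable_segment_integral.
rewrite (_ : (fun _ => _) = (fun x => (V (x + (s * t) *: e))%:E) \- (EFin \o V))%E//.
by apply: integrableB => //; exact: integrable_translation.
Qed.

(** The last premise is the weak derivative identity tested with [segment_avg], whose derivative
    along e is the finite difference of [phi]. A translation moves that difference onto V, and
    adjointness moves the averaging onto [G]. *)
Lemma integral_translation_defect (V : 'rV[R]_n -> R) :
  mu.-integrable setT (EFin \o V) -> s ^+ 2 = 1 ->
  (\int[mu]_x (V x * (s * (phi x - phi (x - (s * t) *: e))))%:E =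
   - \int[mu]_x (G x * segment_avg x)%:E)%E ->
  (\int[mu]_x ((phi x)%:E * translation_defect V x) = 0)%E.
Proof.
move=> iV s1 weak.
have mV : measurable_fun setT V.
  by apply/measurable_EFinP; exact: measurable_int iV.
have iphiV : mu.-integrable setT (fun x => (phi x * V x)%:E).
  exact: (integrableMr measurableT mphi bphi iV).
have iphiVt : mu.-integrable setT (fun x => (phi x * V (x + (s * t) *: e))%:E).
  exact: (integrableMr measurableT mphi bphi (integrable_translation _ iV)).
have iphiA : mu.-integrable setT (fun x => (phi x)%:E *
    \int[leb]_(r in I) (G (x + (s * r) *: e))%:E)%E.
  exact: (integrableMr measurableT mphi bphi integrable_segment_integral).
transitivity (\int[mu]_x ((phi x * V (x + (s * t) *: e))%:E - (phi x * V x)%:E -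
   s%:E * ((phi x)%:E * \int[leb]_(r in I) (G (x + (s * r) *: e))%:E)))%E.
  apply: eq_integral => x _; rewrite /translation_defect muleBr//.
  by rewrite EFinM -EFinB -!EFinM mulrBr muleCA.
rewrite integralB//; last 2 first.
- exact: integrableB.
- exact: integrableZl.
rewrite integralB// integralZl// integral_segment_avg.
move/(congr1 oppe): weak; rewrite oppeK => <-.
have -> : (\int[mu]_x (V x * (s * (phi x - phi (x - (s * t) *: e))))%:E =
    s%:E * (\int[mu]_x (phi x * V x)%:E -
            \int[mu]_x (phi x * V (x + (s * t) *: e))%:E))%E.
  have iphiV' : mu.-integrable setT (fun x => (phi (x - (s * t) *: e) * V x)%:E).
    have := integrable_translation (- ((s * t) *: e)) iphiVt.
    by under eq_fun do rewrite subrK.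
  have -> : (\int[mu]_x (phi x * V (x + (s * t) *: e))%:E =
      \int[mu]_x (phi (x - (s * t) *: e) * V x)%:E)%E.
    rewrite -(integral_translation (- ((s * t) *: e)) (measurable_int _ iphiVt)).
    by apply: eq_integral => x _; rewrite subrK.
  rewrite -integralB// -integralZl//; last exact: integrableB.
  apply: eq_integral => x _.
  by rewrite -!EFinB -EFinM; congr _%:E; ring.
have /fineK <- := integrable_fin_num measurableT iphiV.
have /fineK <- := integrable_fin_num measurableT iphiVt.
rewrite -!(EFinB, EFinM, EFinN); congr _%:E.
by rewrite mulrN opprK mulrA -expr2 s1 mul1r; ring.
Qed.

End translation_fubini_test.

(** * The fundamental theorem of calculus along a coordinate direction for weak gradients *)

Section weak_translation.
Context {R : realType} {n : nat}.
Local Notation mu := (lebesgue_rV R n).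
Local Notation leb := (@lebesgue_measure R).
Variables (i : 'I_n) (s t : R).
Hypotheses (s1 : s ^+ 2 = 1) (t0 : 0 < t).
Local Notation e := (delta_mx ord0 i : 'rV[R]_n).
Implicit Types (a b x : 'rV[R]_n) (m : nat).

Definition bump_box a b m := tensor (fun j => bump (a ord0 j) (b ord0 j) m).

(** Averaging a product along the i-th axis changes its i-th factor only. This closed form of
    [segment_avg] applied to [bump_box] makes smoothness and the i-th partial derivative visible. *)
Definition bump_box_avg a b m := tensor (fun j =>
  if j == i then shift_avg (bump (a ord0 j) (b ord0 j) m) s t
  else bump (a ord0 j) (b ord0 j) m).

Lemma bump_box01 a b m x : 0 <= bump_box a b m x <= 1.
Proof.
apply/andP; split; first by apply: prodr_ge0 => j _; exact: bump_ge0.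
by apply: prodr_ile1 => j _; rewrite bump_ge0 bump_le1.
Qed.

Lemma bump_box_neq0 a b m x : bump_box a b m x != 0 -> obox a b x.
Proof.
move=> /prodf_neq0 h j; have := h j isT; apply: contraNT => /bump_out ->.
exact/eqP.
Qed.

Lemma continuous_bump_box a b m : continuous (bump_box a b m).
Proof.
by apply: (@CNd_continuous R n 0); apply: CNd_prod => j; exact: bump_C1d.
Qed.

Lemma cvg_bump_box a b x : bump_box a b m x @[m --> \oo] --> (\1_(obox a b) x : R).
Proof.
rewrite indicE; case: (boolP (x \in obox a b)) => [/set_mem xab|/negP xab].
  rewrite [X in _ --> X](_ : _ = \prod_(j < n) (1 : R)); last by rewrite big1.
  rewrite /bump_box /tensor; elim: (index_enum _) => [|j r IHr].
    by under eq_fun do rewrite big_nil; rewrite big_nil; exact: cvg_cst.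
  under eq_fun do rewrite big_cons.
  by rewrite big_cons; apply: cvgM => //; exact: cvg_bump.
rewrite (_ : (fun _ => _) = cst 0); first exact: cvg_cst.
apply/funext => m; apply/eqP/negP => /negP/bump_box_neq0 xab'.
by apply: xab; rewrite inE.
Qed.

Lemma coord_shift x (c : R) j : (x - c *: e) ord0 j = x ord0 j - (if j == i then c else 0).
Proof. by rewrite !mxE eqxx/=; case: eqP => _; rewrite ?mulr1 ?mulr0. Qed.

Lemma segment_avg_bump_box a b m x :
  segment_avg e s t (bump_box a b m) x = bump_box_avg a b m x.
Proof.
rewrite /bump_box_avg /tensor (bigD1 i)//= eqxx /segment_avg.
have cb : continuous (fun r : R => bump (a ord0 i) (b ord0 i) m (x ord0 i - s * r)).
  move=> r; apply: (@continuous_comp _ _ _ (fun r : R => x ord0 i - s * r)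
    (bump (a ord0 i) (b ord0 i) m)).
    by apply: cvgB; [exact: cvg_cst|apply: cvgM; [exact: cvg_cst|exact: cvg_id]].
  exact: C1d_continuous (bump_C1d 0 _ _ m) _.
rewrite mulrC -RintegralZl//.
  apply: eq_Rintegral => r _; rewrite /bump_box /tensor (bigD1 i)//= mulrC.
  rewrite coord_shift eqxx; congr (_ * _).
  by apply: eq_bigr => j /negbTE ji; rewrite coord_shift ji subr0.
apply: continuous_compact_integrable; first exact: segment_compact.
exact: continuous_subspaceT.
Qed.

Lemma bump_C1d_out (a b : R) m (x : R) : x <= a -> bump a b m x = 0 :> R.
Proof. by move=> xa; apply: bump_out; rewrite ltNge xa. Qed.

Lemma smooth_bump_box_avg a b m : smooth (bump_box_avg a b m).
Proof.
apply: smooth_tensor => j k; case: ifP => _; last exact: bump_C1d.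
by apply: (shift_avg_C1d (a := a ord0 j)) => //;
  [exact: bump_C1d|move=> y; exact: bump_C1d_out].
Qed.

Lemma partial_bump_box_avg a b m x : partial i (bump_box_avg a b m) x =
  s * (bump_box a b m x - bump_box a b m (x - (s * t) *: e)).
Proof.
pose f j := if j == i then shift_avg (bump (a ord0 j) (b ord0 j) m) s t
  else bump (a ord0 j) (b ord0 j) m.
have df : is_derive (x ord0 i) 1 (f i)
   (s * (bump (a ord0 i) (b ord0 i) m (x ord0 i) -
   bump (a ord0 i) (b ord0 i) m (x ord0 i - s * t))).
  rewrite /f eqxx; apply: (is_derive_shift_avg (a := a ord0 i)) => //.
  - exact: C1d_continuous (bump_C1d 0 _ _ m).
  - by move=> y; exact: bump_C1d_out.
rewrite (partial_tensor df) /f.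
rewrite -mulrA; congr (_ * _); rewrite mulrBl.
congr (_ - _); rewrite /bump_box /tensor [RHS](bigD1 i)//=.
  by congr (_ * _); apply: eq_bigr => j /negbTE ->.
rewrite coord_shift eqxx; congr (_ * _).
by apply: eq_bigr => j /negbTE ji; rewrite coord_shift ji subr0.
Qed.

Lemma cboxS a b a' b' : (forall j, a ord0 j <= a' ord0 j) ->
  (forall j, b' ord0 j <= b ord0 j) -> cbox a' b' `<=` cbox a b.
Proof.
move=> aa bb x xab j; have /andP[ax xb] := xab j.
by rewrite (le_trans (aa j) ax) (le_trans xb (bb j)).
Qed.

(** Testing with averaged bumps shows that the translation defect integrates to 0 over every box
    inside the given one, hence vanishes almost everywhere there. *)
Lemma weak_translation (U : set 'rV[R]_n) (v : 'rV[R]_n -> R) g a b :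
  open U -> is_weak_gradient U v g ->
  (forall x r, cbox a b x -> 0 <= r <= t -> U (x + (s * r) *: e)) ->
  {ae mu, forall x, obox a b x -> ((v (x + (s * t) *: e) - v x)%:E =
    s%:E * \int[leb]_(r in `[0%R, t]) (g (x + (s * r) *: e) ord0 i)%:E)%E}.
Proof.
move=> oU [[mv iv] ig weak] abU; have [mg {}ig] := ig i.
(* The compact set swept by the closed box. As [v] and [g] are only locally integrable on [U], they
   are cut off to [K], which makes them integrable on the whole space without changing anything
   along the segments used. *)
pose K := [set z.2 + (s * z.1) *: e | z in `[0, t] `*` cbox a b].
have cK : compact K.
  apply: continuous_compact.
    apply: continuous_subspaceT => z; apply: cvgD; first exact: cvg_snd.
    apply: cvgZ; last exact: cvg_cst.
    by apply: cvgM; [exact: cvg_cst|exact: cvg_fst].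
  by apply: compact_setX; [exact: segment_compact|exact: compact_cbox].
have KU : K `<=` U.
  by move=> _ [[r x] [/= + xab] <-]; rewrite in_itv/= => r0t; exact: abU.
have mK : measurable K.
  have clK : closed K by apply: compact_closed => //; exact: norm_hausdorff.
  rewrite -[K]setCK; apply: measurableC; apply: open_measurable_rV.
  by rewrite openC.
have abK x r : cbox a b x -> 0 <= r <= t -> K (x + (s * r) *: e).
  by move=> xab r0t; exists (r, x).
have abK0 x : cbox a b x -> K x.
  by move=> xab; have := abK x 0 xab; rewrite mulr0 scale0r addr0; apply; rewrite lexx ltW.
have mU : measurable U := open_measurable_rV oU.
pose V := v \_ K; pose G := (fun x => g x ord0 i) \_ K.
have iV : mu.-integrable setT (EFin \o V).
  rewrite -restrict_EFin; apply/integrable_restrict => //; rewrite setTI.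
  apply/integrableP; split; last exact: iv.
  by apply/measurable_EFinP; exact: measurable_funS mU KU mv.
have iG : mu.-integrable setT (EFin \o G).
  rewrite -restrict_EFin; apply/integrable_restrict => //; rewrite setTI.
  apply/integrableP; split; last exact: ig.
  by apply/measurable_EFinP; exact: measurable_funS mU KU mg.
(* For each m the integral against the bump is 0. Dominated convergence, with the absolute value of
   the defect as majorant, replaces the bump by the indicator of the box. *)
have defect0 a' b' : cbox a' b' `<=` cbox a b ->
    (\int[mu]_(x in obox a' b') translation_defect e s t G V x = 0)%E.
  move=> ab'.
  have step m : (\int[mu]_x ((bump_box a' b' m x)%:E * translation_defect e s t G V x) = 0)%E.
    apply: integral_translation_defect => //.
    - apply: continuous_measurable_rV; exact: continuous_bump_box.
    - exact: bump_box01.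
    have bK x : bump_box a' b' m x != 0 -> K x.
      by move=> /bump_box_neq0/sub_obox_cbox/ab'/abK0.
    have bK' x r : 0 <= r <= t -> bump_box a' b' m (x - (s * r) *: e) != 0 -> K x.
      move=> r0t /bump_box_neq0/sub_obox_cbox/ab'/abK => /(_ _ r0t).
      by rewrite subrK.
    (* A nonzero average at x forces x - s r e into the box for some r in [0, t], so x lies on a
       segment issuing from the box. *)
    have suppK x : bump_box_avg a' b' m x != 0 -> K x.
      apply: contraNP => xK; rewrite -segment_avg_bump_box /segment_avg.
      rewrite /Rintegral integral0_eq// => r /=; rewrite in_itv/= => r0t.
      congr _%:E; apply/eqP/negP => /negP/(bK' _ _ r0t); exact: xK.
    have test : test_function U (bump_box_avg a' b' m).
      have [sK cS] := closure_support_sub cK suppK.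
      by split=> //; [exact: smooth_bump_box_avg|exact: subset_trans sK KU].
    have := weak i _ test.
    have -> : (\int[mu]_(x in U) (v x * partial i (bump_box_avg a' b' m) x)%:E =
       \int[mu]_x (V x * (s * (bump_box a' b' m x -
          bump_box a' b' m (x - (s * t) *: e))))%:E)%E.
      rewrite integral_mkcond; apply: eq_integral => x _.
      rewrite patchE partial_bump_box_avg /V patchE.
      have [xK|xK] := boolP (x \in K).
        by rewrite mem_set//; apply: KU; exact/set_mem.
      have z0 r : 0 <= r <= t -> bump_box a' b' m (x - (s * r) *: e) = 0.
        move=> r0t; apply/eqP; apply: contraNT xK => /(bK' _ _ r0t) xK.
        by rewrite inE.
      rewrite (z0 t) ?lexx ?ltW//; have := z0 0; rewrite mulr0 scale0r subr0.
      by move=> ->; rewrite ?lexx ?ltW// subrr !mulr0 if_same.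
    have -> : (\int[mu]_(x in U) (g x ord0 i * bump_box_avg a' b' m x)%:E =
        \int[mu]_x (G x * segment_avg e s t (bump_box a' b' m) x)%:E)%E.
      rewrite integral_mkcond; apply: eq_integral => x _.
      rewrite patchE /G patchE segment_avg_bump_box.
      have [xK|xK] := boolP (x \in K).
        by rewrite mem_set//; apply: KU; exact/set_mem.
      rewrite (_ : bump_box_avg _ _ _ _ = 0) ?mulr0 ?if_same//.
      by apply/eqP; apply: contraNT xK => /suppK xK; rewrite inE.
    exact.
  have iH : mu.-integrable setT (translation_defect e s t G V).
    exact: integrable_translation_defect.
  have mH := measurable_int _ iH.
  pose F m x := ((bump_box a' b' m x)%:E * translation_defect e s t G V x)%E.
  pose L x := ((\1_(obox a' b') x)%:E * translation_defect e s t G V x)%E.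
  have mF m : measurable_fun setT (F m).
    apply: emeasurable_funM => //; apply/measurable_EFinP.
    by apply: continuous_measurable_rV; exact: continuous_bump_box.
  have mL : measurable_fun setT L.
    apply: emeasurable_funM => //; apply/measurable_EFinP.
    by apply: measurable_indic; exact: measurable_obox.
  have FL : {ae mu, forall x, setT x -> F ^~ x @ \oo --> L x}.
    have := integrable_ae measurableT iH; apply: filterS => x /(_ I) fx _.
    rewrite /F /L -(fineK fx); apply: cvgeM => //.
    + by apply: cvg_EFin; [exact: nearW|exact: cvg_bump_box].
    + exact: cvg_cst.
  have FH : {ae mu, forall x m, setT x -> (`|F m x| <= `|translation_defect e s t G V x|)%E}.
    apply: aeW => x m _; rewrite abseM -[leRHS]mul1e lee_wpmul2r//=.
    by have /andP[h0 h1] := bump_box01 a' b' m x; rewrite lee_fin ger0_norm.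
  have [_ _ ] := dominated_convergence measurableT mF mL FL (integrable_abse iH) FH.
  rewrite (_ : [sequence _]_n = cst 0%E); last by apply/funext => m; exact: step.
  move=> cL; have h : (0 = \int[mu]_x L x)%E.
    by apply: cvg_unique cL; [exact: ereal_hausdorff|exact: cvg_cst].
  rewrite integral_mkcond [RHS]h.
  apply: eq_integral => x _; rewrite patchE /L indicE.
  by case: ifP => _; rewrite ?mul1e ?mul0e.
have iH : mu.-integrable setT (translation_defect e s t G V).
  exact: integrable_translation_defect.
have aeH : ae_eq mu (obox a b) (translation_defect e s t G V) (cst 0%E).
  apply: ae_eq0_of_obox.
  - exact: measurable_obox.
  - by apply: integrableS iH => //; exact: measurable_obox.
  - exact: defect0.
  - move=> a' b'.
    rewrite oboxI; apply: defect0; apply: cboxS => j; rewrite mxE.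
      by rewrite le_max lexx.
    by rewrite ge_min lexx.
apply: filterS aeH => x /= + abx => /(_ abx).
have abx' := sub_obox_cbox abx.
rewrite /translation_defect /V /G !patchE !mem_set//; last 2 first.
- exact: abK0.
- by apply: abK => //; rewrite lexx ltW.
have -> : (\int[leb]_(r in `[0%R, t]) (((fun x => g x ord0 i) \_ K) (x + (s * r) *: e))%:E
   = \int[leb]_(r in `[0%R, t]) (g (x + (s * r) *: e) ord0 i)%:E)%E.
  apply: eq_integral => r; rewrite inE/= in_itv/= => r0t.
  by rewrite patchE mem_set//; exact: abK.
(* An infinite integral would make the defect infinite, contradicting its vanishing; only the finite
   case remains. *)
case: (_ * _)%E => [y| |] //=.
by rewrite -EFinB => -[] /eqP; rewrite subr_eq0 => /eqP ->.
Qed.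

End weak_translation.

(** * The signed distance near the boundary *)

Section euclidean_norm.
Context {R : realType} {n : nat}.
Implicit Types (x y z : 'rV[R]_n) (A D : set 'rV[R]_n).

Definition sqnorm x := \sum_(i < n) x ord0 i ^+ 2.

Lemma sqnorm_ge0 x : 0 <= sqnorm x.
Proof. by apply: sumr_ge0 => i _; exact: sqr_ge0. Qed.

Lemma enorm_ge0 x : 0 <= enorm x.
Proof. exact: sqrtr_ge0. Qed.

Lemma sqr_enorm x : enorm x ^+ 2 = sqnorm x.
Proof. by rewrite sqr_sqrtr// sqnorm_ge0. Qed.

Lemma enormZ (c : R) x : enorm (c *: x) = `|c| * enorm x.
Proof.
rewrite /enorm -sqrtr_sqr -sqrtrM ?sqr_ge0// mulr_sumr; congr Num.sqrt.
by apply: eq_bigr => i _; rewrite mxE exprMn.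
Qed.

Lemma enormN x : enorm (- x) = enorm x.
Proof. by rewrite -scaleN1r enormZ normrN1 mul1r. Qed.

Lemma enormB x y : enorm (x - y) = enorm (y - x).
Proof. by rewrite -enormN opprB. Qed.

Lemma enorm0 : enorm (0 : 'rV[R]_n) = 0.
Proof. by rewrite -(scale0r 0) enormZ normr0 mul0r. Qed.

Lemma coord_le_enorm x i : `|x ord0 i| <= enorm x.
Proof.
rewrite -sqrtr_sqr ler_wsqrtr// (bigD1 i)//= lerDl.
by apply: sumr_ge0 => j _; exact: sqr_ge0.
Qed.

Lemma enorm_delta (i : 'I_n) : enorm (delta_mx ord0 i : 'rV[R]_n) = 1.
Proof.
rewrite /enorm (bigD1 i)//= big1 => [|j /negbTE ji].
  by rewrite mxE !eqxx expr1n addr0 sqrtr1.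
by rewrite mxE ji andbF expr0n.
Qed.


Lemma enorm_eq0 x : enorm x = 0 -> x = 0.
Proof.
move=> x0; apply/rowP => i; rewrite mxE; apply/eqP.
by rewrite -normr_le0 -x0 coord_le_enorm.
Qed.

(** With a, b the two norms and s the inner product, the sum of the squares (b x_i - a y_i)^2 equals
    2ab(ab - s). If ab = 0, one of the vectors is 0. *)
Lemma cauchy_schwarz x y :
  \sum_(i < n) x ord0 i * y ord0 i <= enorm x * enorm y.
Proof.
set a := enorm x; set b := enorm y; set s := (\sum_(i < n) _).
have a0 : 0 <= a := enorm_ge0 x; have b0 : 0 <= b := enorm_ge0 y.
have h : 0 <= 2 * (a * b) * (a * b - s).
  have : 0 <= \sum_(i < n) (b * x ord0 i - a * y ord0 i) ^+ 2.
    by apply: sumr_ge0 => i _; exact: sqr_ge0.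
  rewrite (_ : \sum_(i < n) _ = b ^+ 2 * sqnorm x + a ^+ 2 * sqnorm y - 2 * (a * b) * s).
    by rewrite -!sqr_enorm -/a -/b; congr (_ <= _); ring.
  rewrite /sqnorm /s !mulr_sumr -big_split -sumrB/=.
  by apply: eq_bigr => i _; ring.
have [ab0|] := ltP 0 (a * b).
  by move: h; rewrite pmulr_rge0 ?subr_ge0// mulr_gt0.
move=> ab0; have /eqP : a * b = 0 by apply/eqP; rewrite eq_le ab0 mulr_ge0.
rewrite mulf_eq0 => /orP[] /eqP/enorm_eq0 z0; rewrite /s z0 big1 ?mulr_ge0//.
  by move=> i _; rewrite mxE mul0r.
by move=> i _; rewrite mxE mulr0.
Qed.

Lemma ler_enormD x y : enorm (x + y) <= enorm x + enorm y.
Proof.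
rewrite -(@ler_pXn2r _ 2)// ?nnegrE ?addr_ge0 ?enorm_ge0//.
rewrite sqr_enorm sqrrD !sqr_enorm (_ : sqnorm (x + y) =
  sqnorm x + (\sum_(i < n) x ord0 i * y ord0 i) *+ 2 + sqnorm y); last first.
  rewrite /sqnorm -sumrMnl -!big_split/=; apply: eq_bigr => i _.
  by rewrite mxE sqrrD.
by rewrite lerD2r lerD2l lerMn2r cauchy_schwarz.
Qed.

Lemma norm_le_enorm x : `|x| <= enorm x.
Proof.
rewrite [leLHS]/Num.norm /= mx_normrE; apply/bigmax_leP; split.
  exact: enorm_ge0.
by move=> [i j] _ /=; rewrite ord1; exact: coord_le_enorm.
Qed.

Lemma enorm_le_norm x : enorm x <= n%:R * `|x|.
Proof.
rewrite -(@ler_pXn2r _ 2)// ?nnegrE ?mulr_ge0 ?enorm_ge0//.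
rewrite sqr_enorm exprMn.
have /le_trans -> // : sqnorm x <= n%:R * `|x| ^+ 2.
  rewrite /sqnorm mulr_natl -[X in _ *+ X](card_ord n) -sumr_const ler_sum// => i _.
  rewrite -real_normK ?num_real// ler_pXn2r// ?nnegrE//.
  rewrite [leRHS]/Num.norm /= mx_normrE.
  exact: (le_bigmax _ (fun ij => `|x ij.1 ij.2|) (ord0, i)).
rewrite ler_wpM2r ?sqr_ge0// -natrX ler_nat expnS expn1.
by case: (n) => // k; rewrite leq_pmulr.
Qed.

Let has_inf_dist A x : A !=set0 -> has_inf [set enorm (x - y) | y in A].
Proof.
move=> [y Ay]; split; first by exists (enorm (x - y)), y.
by exists 0 => _ [z _ <-]; exact: enorm_ge0.
Qed.

Lemma dist_le A x y : A y -> dist x A <= enorm (x - y).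
Proof.
move=> Ay; apply: ge_inf; last by exists y.
by exists 0 => _ [z _ <-]; exact: enorm_ge0.
Qed.

Lemma le_dist A x c : A !=set0 -> (forall y, A y -> c <= enorm (x - y)) ->
  c <= dist x A.
Proof.
move=> A0 h; apply: lb_le_inf; first by case: (has_inf_dist x A0).
by move=> _ [y Ay <-]; exact: h.
Qed.

Lemma dist_lt A x c : A !=set0 -> dist x A < c ->
  exists2 y, A y & enorm (x - y) < c.
Proof.
move=> A0 /(inf_lt (has_inf_dist x A0).1)[_ [y Ay <-] h]; by exists y.
Qed.

Lemma dist_ge0 A x : A !=set0 -> 0 <= dist x A.
Proof. by move=> A0; apply: le_dist => // y _; exact: enorm_ge0. Qed.

Lemma dist_mem A x : A x -> dist x A = 0.
Proof.
move=> Ax; apply/eqP; rewrite eq_le dist_ge0 ?andbT; last by exists x.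
by have := dist_le x Ax; rewrite subrr enorm0.
Qed.

Lemma dist_lip A x y : A !=set0 -> dist x A <= dist y A + enorm (x - y).
Proof.
move=> A0; rewrite -lerBlDr; apply: le_dist => // z Az.
rewrite lerBlDr; apply: le_trans (dist_le x Az) _.
have -> : x - z = (y - z) + (x - y) by apply/rowP => j; rewrite !mxE; ring.
exact: ler_enormD.
Qed.


(** The factor 2 adds the Lipschitz constants of the two distances. It is not sharp, but any
    constant independent of eps serves. *)
Lemma signed_dist_lip D x y : D !=set0 -> ~` D !=set0 ->
  `|signed_dist D x - signed_dist D y| <= 2 * enorm (x - y).
Proof.
move=> D0 DC0; rewrite /signed_dist.
have h1 := dist_lip x y D0; have h2 := dist_lip y x D0.
have h3 := dist_lip x y DC0; have h4 := dist_lip y x DC0.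
rewrite enormB in h2; rewrite (enormB y x) in h4.
by rewrite ler_norml; apply/andP; split; lra.
Qed.

Lemma continuous_signed_dist D : D !=set0 -> ~` D !=set0 ->
  continuous (signed_dist D).
Proof.
move=> D0 DC0 x; apply/(@cvgrPdist_le _ _ _ _ (nbhs_filter x)) => eps eps0.
have n0 : 0 < n.+1%:R :> R by rewrite ltr0Sn.
apply/nbhs_ballP; exists (eps / (2 * n.+1%:R)) => /=.
  by rewrite divr_gt0// mulr_gt0.
move=> y; rewrite -ball_normE /= ltr_pdivlMr ?mulr_gt0// => /ltW xy.
apply: le_trans (signed_dist_lip x y D0 DC0) _; apply: le_trans xy.
rewrite (_ : `|x - y| * _ = 2 * (n.+1%:R * `|x - y|)); last by ring.
rewrite ler_wpM2l//.
apply: le_trans (enorm_le_norm _) _.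
by rewrite ler_wpM2r// ler_nat.
Qed.

Lemma dist_closure D x0 : closure D x0 -> dist x0 D = 0.
Proof.
move=> clx0; have D0 : D !=set0 by have [y [Dy _]] := clx0 setT filterT; exists y.
apply/eqP; rewrite eq_le dist_ge0// andbT; apply/ler_addgt0Pl => d d0.
have n0 : 0 < n.+1%:R :> R by rewrite ltr0Sn.
have [y [Dy]] := clx0 _ (nbhsx_ballx x0 _ (divr_gt0 d0 n0)).
rewrite -ball_normE /= ltr_pdivlMr// => yd; rewrite addr0.
apply: le_trans (dist_le x0 Dy) _; apply: le_trans (enorm_le_norm _) _.
by apply: le_trans (ltW yd); rewrite mulrC ler_wpM2l// ler_nat.
Qed.

(** A uniform interior cone condition: the same truncated cone of axis [e] and slope [c] can be
    attached at every point of [D] near [x0], not only at [x0]. *)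
Definition cone_property D x0 (r c : R) (e : 'rV[R]_n) :=
  forall x z (t : R), D x -> enorm (x - x0) < r -> 0 <= t <= r ->
  enorm z <= c * t -> D (x + t *: e + z).

(** The cone pushes a ball of radius c t around y + t e into [D] for every nearby y in [D]. The
    cases are the positions of x and x + t e relative to [D]; near-minimizers replace nearest
    points. The factor 4 leaves room for these points, which stay within 4r of [x0]. *)
Lemma signed_dist_cone D x0 (r c : R) e x (t : R) :
  0 < r -> 0 < c -> enorm e = 1 -> D !=set0 -> closure D x0 -> ~ D x0 ->
  cone_property D x0 (4 * r) c e ->
  enorm (x - x0) < r -> 0 <= t <= r ->
  signed_dist D (x + t *: e) <= signed_dist D x - c * t.
Proof.
move=> r0 c0 e1 D0 clx0 nx0 cone xr tr.
have DC0 : ~` D !=set0 by exists x0.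
have t4r : 0 <= t <= 4 * r by case/andP: tr => t0 tr; rewrite t0/=; lra.
have /andP[t0 tr'] := tr.
have ct0 : 0 <= c * t by rewrite mulr_ge0 ?(ltW c0).
have te : enorm (t *: e) <= r.
  by rewrite enormZ e1 mulr1 ger0_norm.
(* The cone property read contrapositively: a point outside [D] is farther than c t from every
   shifted point y + t e. *)
have sep y z : D y -> enorm (y - x0) < 4 * r -> ~ D z ->
    c * t < enorm (z - y - t *: e).
  move=> Dy yr Dz; rewrite ltNge; apply/negP => h; apply: Dz.
  have := cone y (z - y - t *: e) t Dy yr t4r h.
  rewrite (_ : _ + _ = z)//; by apply/rowP => j; rewrite !mxE; ring.
have distx : dist x D <= enorm (x - x0).
  by rewrite -[leRHS]add0r -(dist_closure clx0); exact: dist_lip.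
have distxt : dist (x + t *: e) (~` D) < 2 * r.
  apply: le_lt_trans (dist_le _ nx0) _.
  have -> : x + t *: e - x0 = (x - x0) + t *: e by rewrite addrAC.
  by apply: le_lt_trans (ler_enormD _ _) _; lra.
(* Splits a vector longer than c t into a part of length c t, absorbed by the cone, and a remainder
   shorter by exactly c t. *)
have shrink (w : 'rV[R]_n) : c * t < enorm w -> let k := c * t / enorm w in
    [/\ 0 <= k <= 1, enorm (k *: w) <= c * t & enorm (w - k *: w) = enorm w - c * t].
  move=> ctw k; have w0 : 0 < enorm w := le_lt_trans ct0 ctw.
  have kw : k * enorm w = c * t by rewrite /k divfK// gt_eqF.
  have k0 : 0 <= k by rewrite divr_ge0// ltW.
  have k1 : k <= 1 by rewrite /k ler_pdivrMr// mul1r ltW.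
  split; first by rewrite k0.
    by rewrite enormZ ger0_norm// kw.
  rewrite -{1}[w]scale1r -scalerBl enormZ ger0_norm ?subr_ge0//.
  by rewrite mulrBl mul1r kw.
(* Both points outside: a point y of [D] nearly closest to x, shifted by t e and then moved by c t
   towards x + t e, is still in [D]. *)
have [Dxt|Dxt] := pselect (D (x + t *: e)); last first.
  have Dx : ~ D x.
    move=> Dx; apply: Dxt; rewrite -[X in D X]addr0; apply: cone => //.
      by apply: lt_le_trans xr _; lra.
    by rewrite enorm0.
  rewrite /signed_dist (dist_mem (A := ~` D) Dx) (dist_mem (A := ~` D) Dxt) !subr0.
  apply/ler_addgt0Pl => d d0.
  have [|y Dy yx] := @dist_lt D x (dist x D + Num.min d r) D0.
    by rewrite ltrDl lt_min d0.
  have dr : Num.min d r <= r by rewrite ge_min lexx orbT.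
  have dd : Num.min d r <= d by rewrite ge_min lexx.
  have yx0 : enorm (y - x0) < 4 * r.
    have -> : y - x0 = (y - x) + (x - x0) by apply/rowP => j; rewrite !mxE; ring.
    apply: le_lt_trans (ler_enormD _ _) _; rewrite enormB; lra.
  have := sep y _ Dy yx0 Dxt.
  have -> : x + t *: e - y - t *: e = x - y by apply/rowP => j; rewrite !mxE; ring.
  move=> /shrink[k01 kw wkw].
  have := cone y _ t Dy yx0 t4r kw => Dp.
  apply: le_trans (dist_le _ Dp) _.
  set w := x - y in wkw *.
  have -> : x + t *: e - (y + t *: e + c * t / enorm w *: w) =
      w - c * t / enorm w *: w.
    by apply/rowP => j; rewrite !mxE; ring.
  by rewrite wkw /w; lra.
(* Both points inside: shortening the vector from x + t e to a nearly closest z outside [D] and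
   attaching it at x leads outside [D], since otherwise the cone would put z in [D]. *)
have [Dx|Dx] := pselect (D x).
  rewrite /signed_dist (dist_mem Dx) (dist_mem Dxt) !sub0r lerNl opprB opprK.
  rewrite addrC; apply/ler_addgt0Pl => d d0.
  have [|z Dz zx] := @dist_lt (~` D) (x + t *: e) (dist (x + t *: e) (~` D) + Num.min d r) DC0.
    by rewrite ltrDl lt_min d0.
  have dr : Num.min d r <= r by rewrite ge_min lexx orbT.
  have dd : Num.min d r <= d by rewrite ge_min lexx.
  have xr4 : enorm (x - x0) < 4 * r by apply: lt_le_trans xr _; lra.
  have /shrink := sep x z Dx xr4 Dz; set w := z - x - t *: e => -[k01 kw wkw].
  have wE : enorm w = enorm (x + t *: e - z).
    by rewrite enormB /w; congr enorm; apply/rowP => j; rewrite !mxE; ring.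
  set q := w - _ in wkw.
  have DCp : (~` D) (x + q).
    move=> Dp; apply: Dz.
    have pr : enorm (x + q - x0) < 4 * r.
      rewrite (_ : x + q - x0 = (x - x0) + q); last by apply/rowP => j; rewrite !mxE; ring.
      by apply: le_lt_trans (ler_enormD _ _) _; rewrite wkw wE; lra.
    have := cone _ _ t Dp pr t4r kw.
    rewrite (_ : _ + _ = z)// /q /w.
    by apply/rowP => j; rewrite !mxE; ring.
  have := dist_le x DCp; rewrite opprD addrA subrr sub0r enormN wkw wE; lra.
(* The segment enters [D]: [sep] bounds c t by the sum of the distance from x to [D] and that from x
   + t e to the complement, up to the errors d / 2. *)
rewrite /signed_dist (dist_mem Dxt) (dist_mem (A := ~` D) Dx) subr0 sub0r.
apply/ler_addgt0Pl => d d0.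
have d20 : 0 < d / 2 by rewrite divr_gt0.
have [|y Dy yx] := @dist_lt D x (dist x D + Num.min (d / 2) r) D0.
  by rewrite ltrDl lt_min d20.
have [|z Dz zx] := @dist_lt (~` D) (x + t *: e) (dist (x + t *: e) (~` D) + Num.min (d / 2) r) DC0.
  by rewrite ltrDl lt_min d20.
have dr : Num.min (d / 2) r <= r by rewrite ge_min lexx orbT.
have dd : Num.min (d / 2) r <= d / 2 by rewrite ge_min lexx.
have yx0 : enorm (y - x0) < 4 * r.
  have -> : y - x0 = (y - x) + (x - x0) by apply/rowP => j; rewrite !mxE; ring.
  by apply: le_lt_trans (ler_enormD _ _) _; rewrite enormB; lra.
have := sep y z Dy yx0 Dz.
have -> : z - y - t *: e = (x - y) - (x + t *: e - z).
  by apply/rowP => j; rewrite !mxE; ring.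
have := ler_enormD (x - y) (- (x + t *: e - z)); rewrite enormN; lra.
Qed.

End euclidean_norm.

(** * From a C^{1,1} chart to an interior cone along a coordinate axis *)

Section strict_differentiability.
Context {R : realType} {n : nat}.
Implicit Types (x y v : 'rV[R]_n) (f : 'rV[R]_n -> R).

Lemma is_derive_line f x v (r : R) : differentiable f (x + r *: v) ->
  is_derive r 1 (fun r : R => f (x + r *: v))
    (\sum_(j < n) partial j f (x + r *: v) * v ord0 j).
Proof.
move=> df.
have dfv : derivable f (x + r *: v) v by exact: diff_derivable.
have E : (fun h : R => h^-1 *: (((fun r : R => f (x + r *: v)) \o shift r) (h *: 1)
      - f (x + r *: v))) =
    (fun h => h^-1 *: ((f \o shift (x + r *: v)) (h *: v) - f (x + r *: v))).
  apply/funext => h /=; congr (_ *: (f _ - _)).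
  by apply/rowP => j; rewrite !mxE /GRing.scale/=; ring.
apply: DeriveDef; first by rewrite /derivable E.
rewrite /derive E -/(derive f _ v) deriveE//.
rewrite [X in 'd f _ X](row_sum_delta v) linear_sum/=; apply: eq_bigr => j _.
by rewrite linearZ/= /partial deriveE// mulrC.
Qed.

Lemma lipschitz_continuous_at f x : lipschitz f -> {for x, continuous f}.
Proof.
move=> [M [_ Mf]]; pose K := Num.max 1 (M + 1).
have K0 : 0 < K by rewrite lt_max ltr01.
have Kf y z : `|f y - f z| <= K * `|y - z|.
  have MK : M < K by rewrite lt_max ltrDl ltr01 orbT.
  exact: (Mf K MK (y, z)).
apply/(@cvgrPdist_le _ _ _ _ (nbhs_filter x)) => eps eps0.
apply/nbhs_ballP; exists (eps / K); first exact: divr_gt0.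
move=> y; rewrite -ball_normE /= ltr_pdivlMr// => /ltW xy.
by apply: le_trans (Kf x y) _; rewrite mulrC.
Qed.

(** Strict differentiability: the differential at [y0] also approximates increments between two
    other nearby points, by the mean value theorem and continuity of the partial derivatives. This
    uniformity lets one cone serve all base points near [x0]. *)
Lemma class_C11_strict f y0 (eta : R) : class_C11 f -> 0 < eta ->
  exists2 d : R, 0 < d & forall x y, `|x - y0| < d -> `|y - y0| < d ->
    `|f y - f x - \sum_(j < n) partial j f y0 * (y - x) ord0 j| <= eta * `|y - x|.
Proof.
move=> [df Lf] eta0.
(* The n partial derivatives each contribute an error [eta'] in the sup norm; n + 1 avoids a
   division by 0. *)
pose eta' := eta / n.+1%:R; have eta'0 : 0 < eta' by rewrite divr_gt0.
have : \forall z \near y0, forall j, `|partial j f y0 - partial j f z| <= eta'.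
  apply: (@filter_forall _ _ (fun j z => `|partial j f y0 - partial j f z| <= eta')
    _ (nbhs_filter y0)) => j.
  have := lipschitz_continuous_at (x := y0) (Lf j).
  by move/(@cvgrPdist_le _ _ _ _ (nbhs_filter y0)); apply.
move=> /nbhs_ballP[d /= d0 hd]; exists d => // x y xd yd.
have [c /=] : exists2 c, c \in `]0, (1 : R)[ & f y - f x =
    \sum_(j < n) partial j f (x + c *: (y - x)) * (y - x) ord0 j.
  pose F (r : R) := f (x + r *: (y - x)).
  pose F' (r : R) := \sum_(j < n) partial j f (x + r *: (y - x)) * (y - x) ord0 j.
  have dF (r : R) : is_derive r 1 F (F' r) by apply: is_derive_line; exact: df.
  have cF : {within `[0, 1], continuous F}.
    apply: continuous_subspaceT => r.
    by apply/differentiable_continuous/derivable1_diffP; case: (dF r).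
  have [c c01] := MVT ltr01 (fun r _ => dF r) cF.
  rewrite /F scale1r scale0r addr0 subr0 mulr1.
  rewrite (_ : x + (y - x) = y) => [h|]; last by rewrite addrC subrK.
  by exists c.
rewrite in_itv/= => /andP[c0 c1] ->.
rewrite -sumrB; apply: le_trans (ler_norm_sum _ _ _) _.
apply: le_trans (_ : \sum_(j < n) eta' * `|y - x| <= _).
  apply: ler_sum => j _; rewrite -mulrBl normrM ler_pM//; last exact: norm_coord_le.
  rewrite distrC; apply: hd; rewrite -ball_normE /=.
  have -> : y0 - (x + c *: (y - x)) = - ((1 - c) *: (x - y0) + c *: (y - y0)).
    by apply/rowP => k; rewrite !mxE; ring.
  rewrite normrN; apply: le_lt_trans (ler_normD _ _) _.
  rewrite !normrZ ger0_norm ?subr_ge0 ?ltW// ger0_norm ?ltW//.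
  have : (1 - c) * `|x - y0| < (1 - c) * d by rewrite ltr_pM2l// subr_gt0.
  have : c * `|y - y0| < c * d by rewrite ltr_pM2l.
  lra.
rewrite sumr_const card_ord -mulr_natr mulrAC ler_wpM2r//.
by rewrite /eta' mulrAC ler_pdivrMr// ler_wpM2l ?ler_nat// ltW.
Qed.

End strict_differentiability.

Section boundary_cone.
Context {R : realType} {n : nat}.
Implicit Types (D : set 'rV[R]_n.+1).

Lemma enorm_isometry (Q : 'M[R]_n.+1) (x : 'rV[R]_n.+1) : Q *m Q^T = 1%:M ->
  enorm (x *m Q) = enorm x.
Proof.
move=> QQ; have sqE (y : 'rV[R]_n.+1) : sqnorm y = (y *m y^T) ord0 ord0.
  by rewrite mxE; apply: eq_bigr => i _; rewrite mxE expr2.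
have E (y : 'rV[R]_n.+1) : enorm y = Num.sqrt (sqnorm y) by [].
by rewrite !E !sqE trmx_mul mulmxA -(mulmxA x) QQ mulmx1.
Qed.

Lemma norm_col'_le (x : 'rV[R]_n.+1) : `|col' ord_max x| <= enorm x.
Proof.
rewrite [leLHS]/Num.norm /= mx_normrE; apply/bigmax_leP; split.
  exact: enorm_ge0.
by move=> [i j] _ /=; rewrite ord1 mxE; exact: coord_le_enorm.
Qed.

(** In the chart, [D] is where F(x) = (x Q)_last - gamma(other coordinates) is positive. The
    gradient [w] of F at [x0] is not 0, so F grows at rate m = |w_i| along the axis i, with the sign
    of w_i, for some i; a small c keeps part of this growth in a whole cone. *)
Lemma boundary_cone D x0 : C11_boundary D -> (closure D `\` interior D) x0 ->
  exists i s (r c : R), [/\ s ^+ 2 = 1, 0 < r, 0 < c &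
    cone_property D x0 r c (s *: delta_mx ord0 i)].
Proof.
move=> C11 /C11[rho [Q [gamma [rho0 QQ Cg chart]]]].
pose y0 := col' ord_max (x0 *m Q).
(* The gradient of F in the rotated coordinates, (-grad gamma, 1); then [w] is the gradient in the
   original ones and [l] the differential of F at [x0]. *)
pose u : 'cV[R]_n.+1 := \col_k
  (if unlift ord_max k is Some j then - partial j gamma y0 else 1).
pose w : 'rV[R]_n.+1 := (Q *m u)^T.
pose l (h : 'rV[R]_n.+1) := \sum_(k < n.+1) h ord0 k * w ord0 k.
have lE h : l h = (h *m Q) ord0 ord_max -
    \sum_(j < n) partial j gamma y0 * (col' ord_max (h *m Q)) ord0 j.
  transitivity ((h *m Q *m u) ord0 ord0).
    by rewrite -mulmxA mxE; apply: eq_bigr => k _; rewrite /w !mxE.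
  rewrite mxE (bigD1_ord ord_max)//= [u _ _]mxE unlift_none mulr1; congr (_ + _).
  rewrite -sumrN; apply: eq_bigr => j _.
  by rewrite [u _ _]mxE liftK [X in _ = - (_ * X)]mxE mulrN mulrC.
have lD h k : l (h + k) = l h + l k.
  by rewrite /l -big_split/=; apply: eq_bigr => j _; rewrite mxE mulrDl.
have lZ (a : R) h : l (a *: h) = a * l h.
  by rewrite /l mulr_sumr; apply: eq_bigr => j _; rewrite mxE mulrA.
have l_le h : `|l h| <= enorm h * enorm w.
  rewrite ler_norml cauchy_schwarz andbT lerNl -mulN1r -lZ scaleN1r.
  by rewrite -(enormN h) cauchy_schwarz.
(* [Q] is invertible and the last entry of [u] is 1, so Q u is not 0. *)
have [i wi] : exists i, w ord0 i != 0.
  apply/existsP; apply: contraT => /existsPn w0.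
  have : Q^T *m (Q *m u) = u by rewrite mulmxA (mulmx1C QQ) mul1mx.
  rewrite (_ : Q *m u = 0); last first.
    apply/colP => k; have := w0 k; rewrite negbK /w mxE => /eqP ->.
    by rewrite mxE.
  rewrite mulmx0 => /colP/(_ ord_max)/eqP.
  by rewrite !mxE unlift_none eq_sym oner_eq0.
pose s := Num.sg (w ord0 i); pose m := `|w ord0 i|.
have s1 : s ^+ 2 = 1 by rewrite sqr_sg wi.
have m0 : 0 < m by rewrite normr_gt0.
have lm : l (s *: delta_mx ord0 i) = m.
  rewrite lZ /l (bigD1 i)//= big1 => [|j /negbTE ji]; last by rewrite mxE ji andbF mul0r.
  by rewrite mxE !eqxx mul1r addr0 /s /m normrEsg.
have e1 : enorm (s *: delta_mx ord0 i : 'rV[R]_n.+1) = 1.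
  by rewrite enormZ enorm_delta mulr1 /s normr_sg wi.
have m40 : 0 < m / 4 by rewrite divr_gt0.
have [d d0 strict] := class_C11_strict y0 Cg m40.
have W0 := enorm_ge0 w.
(* The gain m t is shared: z costs at most c t |w| <= m t / 2, and since c <= 1 the step has length
   at most 2t, so the error of strict differentiability with tolerance m / 4 costs at most m t /
   2. *)
pose c := Num.min 1 (m / (2 * (enorm w + 1))).
have c0 : 0 < c.
  by rewrite lt_min ltr01 divr_gt0// mulr_gt0// ltr_wpDl.
have c1 : c <= 1 by rewrite ge_min lexx.
have cm : c * enorm w <= m / 2.
  have : c <= m / (2 * (enorm w + 1)) by rewrite ge_min lexx orbT.
  rewrite ler_pdivlMr ?mulr_gt0// ?ltr_wpDl// => h.
  by rewrite ler_pdivlMr//; apply: le_trans h; nra.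
(* The endpoint x + t e + z lies within 3r of [x0], thus in the chart and in the range of strict
   differentiability. *)
pose r := Num.min (rho / 4) (d / 4).
have r0 : 0 < r by rewrite lt_min !divr_gt0.
exists i, s, r, c; split => // x z t Dx xr /andP[t0 tr] zc.
set e := s *: _ in lm e1 *.
have rrho : r <= rho / 4 by rewrite ge_min lexx.
have rd : r <= d / 4 by rewrite ge_min lexx orbT.
have zt : enorm z <= t by apply: le_trans zc _; rewrite ler_piMl.
have hE : enorm (t *: e + z) <= 2 * t.
  by apply: le_trans (ler_enormD _ _) _; rewrite enormZ e1 mulr1 ger0_norm//; lra.
have px0 : enorm (x + t *: e + z - x0) <= 3 * r.
  have -> : x + t *: e + z - x0 = (x - x0) + (t *: e + z).
    by apply/rowP => j; rewrite !mxE; ring.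
  by apply: le_trans (ler_enormD _ _) _; lra.
have xrho : enorm (x - x0) < rho by lra.
set p := x + t *: e + z in px0 *.
have prho : enorm (p - x0) < rho by lra.
have gx := (chart x xrho).1 Dx; apply/(chart p prho).
have colB (a b : 'rV[R]_n.+1) : col' ord_max (a *m Q) - col' ord_max (b *m Q) =
    col' ord_max ((a - b) *m Q).
  by rewrite mulmxBl; apply/rowP => j; rewrite !mxE.
have colE (a : 'rV[R]_n.+1) : `|col' ord_max (a *m Q)| <= enorm a.
  by apply: le_trans (norm_col'_le _) _; rewrite enorm_isometry.
have xd : `|col' ord_max (x *m Q) - y0| < d.
  by rewrite /y0 colB; apply: le_lt_trans (colE _) _; lra.
have pd : `|col' ord_max (p *m Q) - y0| < d.
  by rewrite /y0 colB; apply: le_lt_trans (colE _) _; lra.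
have := strict _ _ xd pd; rewrite !colB.
have px : p - x = t *: e + z by apply/rowP => j; rewrite !mxE; ring.
rewrite px ler_norml => /andP[_ gp].
have := lE (t *: e + z); rewrite lD lZ lm => lpx.
have pmax : (p *m Q) ord0 ord_max = (x *m Q) ord0 ord_max +
    ((t *: e + z) *m Q) ord0 ord_max.
  rewrite (_ : p = x + (t *: e + z)); last by rewrite -px addrC subrK.
  by rewrite mulmxDl [LHS]mxE.
have lz := l_le z; rewrite ler_norml in lz; case/andP: lz => lz _.
have zw : enorm z * enorm w <= t * (m / 2).
  apply: le_trans (ler_wpM2r W0 zc) _.
  by rewrite mulrAC mulrC ler_wpM2l.
have := le_trans (colE _) hE : `|col' ord_max ((t *: e + z) *m Q)| <= 2 * t.
move=> /(ler_wpM2l (ltW m40)) hc.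
rewrite pmax; lra.
Qed.

End boundary_cone.

(** * The phase field *)

Section profile.
Context {R : realType} (S : R -> R).
Hypothesis trS : transition_profile S.

Lemma profile_continuous : continuous S.
Proof.
have [[M [_ SM]] _ _ _] := trS; pose K := Num.max 1 (M + 1).
have K0 : 0 < K by rewrite lt_max ltr01.
have KS y z : `|S y - S z| <= K * `|y - z|.
  have MK : M < K by rewrite lt_max ltrDl ltr01 orbT.
  exact: (SM K MK (y, z)).
move=> x; apply/cvgrPdist_le => eps eps0.
apply/nbhs_ballP; exists (eps / K); first exact: divr_gt0.
move=> y /=; rewrite ltr_pdivlMr// => /ltW xy.
by apply: le_trans (KS x y) _; rewrite mulrC.
Qed.

Lemma profile_ge1 x : 1 <= x -> S x = 1.
Proof.
have [_ S1 _ _] := trS => x1; have x0 : 0 < x := lt_le_trans ltr01 x1.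
by rewrite S1 ger0_norm ?(ltW x0)// divff// gt_eqF.
Qed.

Lemma profile_leN1 x : x <= -1 -> S x = -1.
Proof.
have [_ _ _ SN] := trS => x1.
by rewrite -[x]opprK SN profile_ge1// lerNr.
Qed.

(** The mean value theorem applies on [-1, 1], where S' > 0 inside; beyond, [S] is constant, and the
    mixed cases pass through the values at -1 and 1. *)
Lemma profile_homo : {homo S : x y / x <= y}.
Proof.
have [_ _ S' _] := trS.
have inc x y : -1 <= x -> y <= 1 -> x < y -> S x <= S y.
  move=> x1 y1 xy.
  have dS (z : R) : z \in `]x, y[ -> is_derive z 1 S ('D_1 S z).
    rewrite in_itv/= => /andP[xz zy]; apply: derivableP.
    by have [|//] := S' z; rewrite ltr_norml; apply/andP; split; lra.
  have cS : {within `[x, y], continuous S}.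
    exact/continuous_subspaceT/profile_continuous.
  have [z] := MVT xy dS cS; rewrite in_itv/= => /andP[xz zy] Sxy.
  rewrite -subr_ge0 Sxy mulr_ge0// ?subr_ge0 ?ltW// -derive1E.
  by have [|//] := S' z; rewrite ltr_norml; apply/andP; split; lra.
move=> x y; rewrite le_eqVlt => /predU1P[-> //|xy].
have [y1|y1] := leP y (-1).
  by rewrite !profile_leN1//; lra.
have [x1|x1] := leP 1 x.
  by rewrite !profile_ge1//; lra.
have [x2|x2] := leP x (-1); have [y2|y2] := leP 1 y.
- by rewrite profile_leN1// profile_ge1//; lra.
- by rewrite (profile_leN1 x2) -(profile_leN1 (lexx _)) inc// ltW.
- by rewrite (profile_ge1 y2) -(profile_ge1 (lexx _)) inc// ltW.
- by apply: inc => //; exact: ltW.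
Qed.

Lemma profile_bound x : -1 <= S x <= 1.
Proof.
apply/andP; split.
  have [x1|x1] := leP x (-1); first by rewrite profile_leN1.
  by rewrite -(profile_leN1 (lexx _)) profile_homo// ltW.
have [x1|x1] := leP 1 x; first by rewrite profile_ge1.
by rewrite -(profile_ge1 (lexx _)) profile_homo// ltW.
Qed.

(** Increments of [S] near x are comparable to q |y - x| from both sides with fixed factors. The
    upper bound controls the gradient of the phase field and the lower one its difference quotients,
    so q drops out of their ratio. *)
Lemma profile_growth x : `|x| < 1 -> let q := derive1 S x in 0 < q /\
  exists2 d : R, 0 < d & forall y, `|y - x| < d ->
    `|S y - S x| <= 2 * q * `|y - x| /\ q / 2 * `|y - x| <= `|S y - S x|.
Proof.
move=> x1 q; have [_ _ /(_ x x1)[dS q0] _] := trS; split => //.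
have /cvgrPdist_lt/(_ (q / 2)) : (fun h : R => h^-1 *: ((S \o shift x) (h *: 1) - S x)) h
    @[h --> 0^'] --> q.
  by rewrite /q derive1E; exact: dS.
rewrite divr_gt0// => /(_ isT); rewrite near_withinE => /nbhs_ballP[d /= d0 hd].
exists d => // y yd; have [->|yx] := eqVneq y x.
  by rewrite !subrr !normr0 !mulr0.
have h0 : y - x != 0 by rewrite subr_eq0.
have := hd (y - x); rewrite /ball /= sub0r normrN => /(_ yd h0).
rewrite /GRing.scale/= mulr1 subrK => hq.
set u := _ * (S y - S x) in hq.
have uE : `|S y - S x| = `|u| * `|y - x|.
  by rewrite -normrM /u mulrC mulrA mulfV// mul1r.
have yx0 : 0 <= `|y - x| := normr_ge0 _.
have u0 : q / 2 <= u <= 2 * q.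
  by move: hq; rewrite ltr_distlC => /andP[h1 h2]; apply/andP; split; lra.
have up : 0 <= u by case/andP: u0 => u0 _; apply: le_trans u0; rewrite divr_ge0// ltW.
rewrite uE ger0_norm//; case/andP: u0 => u0 u1.
by split; rewrite ler_wpM2r.
Qed.

End profile.

(** * Gradient bounds where partial derivatives may fail to exist *)

Section gradient_bounds.
Context {R : realType} {n : nat}.
Implicit Types (f : 'rV[R]_n -> R) (x : 'rV[R]_n).

Lemma partial_junk f x j : ~ derivable f x (delta_mx ord0 j) -> partial j f x = 0.
Proof.
move=> ndf; rewrite /partial /derive /lim /lim_in/=; case: xgetP => [l _ fl|//].
by exfalso; apply: ndf; apply/cvg_ex; exists l.
Qed.

Lemma partial_bound f x j (M d : R) : 0 <= M -> 0 < d ->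
  (forall h : R, `|h| < d -> `|f (h *: delta_mx ord0 j + x) - f x| <= M * `|h|) ->
  `|partial j f x| <= M.
Proof.
move=> M0 d0 fM; have [df|/partial_junk ->] :=
  pselect (derivable f x (delta_mx ord0 j)); last by rewrite normr0.
apply: (cvgr_to_le (cvg_norm df)); near=> h.
have h0 : h != 0 by near: h; exact: nbhs_dnbhs_neq.
rewrite /= normrZ normfV ler_pdivrMl ?normr_gt0// mulrC fM//.
by near: h; exact: dnbhs0_lt.
Unshelve. all: by end_near. Qed.

(** Fermat's rule, from the signs of the two one-sided quotients; without a derivative the default
    value is 0 as well. *)
Lemma partial_max f x j : (forall y, f y <= f x) -> partial j f x = 0.
Proof.
move=> fx; have [df|/partial_junk //] := pselect (derivable f x (delta_mx ord0 j)).
apply/eqP; rewrite eq_le; apply/andP; split.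
  apply: (cvgr_to_le (cvg_dnbhs_at_right df)); near=> h.
  have h0 : 0 < h by near: h; exact: nbhs_right_gt.
  by rewrite /= /GRing.scale/= pmulr_rle0 ?invr_gt0// subr_le0.
apply: (cvgr_to_ge (cvg_dnbhs_at_left df)); near=> h.
have h0 : h < 0 by near: h; exact: nbhs_left_lt.
by rewrite /= /GRing.scale/= nmulr_rge0 ?invr_lt0// subr_le0.
Unshelve. all: by end_near. Qed.

Lemma enorm_gradient_le f x (M : R) : 0 <= M ->
  (forall j, `|partial j f x| <= M) -> enorm (gradient f x) <= n%:R * M.
Proof.
move=> M0 fM; apply: le_trans (enorm_le_norm _) _; rewrite ler_wpM2l//.
rewrite [leLHS]/Num.norm /= mx_normrE; apply/bigmax_leP; split => //.
by move=> [i j] _ /=; rewrite mxE.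
Qed.

End gradient_bounds.

Section phase_field_bounds.
Context {R : realType} {n : nat} (S : R -> R) (D : set 'rV[R]_n) (eps : R).
Hypotheses (trS : transition_profile S) (eps0 : 0 < eps).
Hypotheses (D0 : D !=set0) (DC0 : ~` D !=set0).
Local Notation w := (phase_field S D eps).
Local Notation d := (signed_dist D).
Implicit Types (x y : 'rV[R]_n).

Lemma phase_field_ge0 x : 0 <= w x.
Proof.
rewrite /phase_field divr_ge0//; have /andP[h _] := profile_bound trS (- d x / eps).
lra.
Qed.

Lemma phase_field_le1 x : w x <= 1.
Proof.
rewrite /phase_field; have /andP[_ h] := profile_bound trS (- d x / eps).
lra.
Qed.

Lemma phase_field_homo x y : d y <= d x -> w x <= w y.
Proof.
move=> dyx; rewrite /phase_field ler_pM2r// lerD2l; apply: profile_homo => //.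
by rewrite ler_pM2r ?invr_gt0// lerN2.
Qed.

Lemma continuous_phase_field : continuous w.
Proof.
pose g (u : R) := (1 + S (- eps^-1 * u + 0)) / 2.
have cg : continuous g.
  move=> u; apply: cvgM; last exact: cvg_cst.
  apply: cvgD; first exact: cvg_cst.
  apply: (@continuous_comp _ _ _ (fun u => - eps^-1 * u + 0) S); last exact: profile_continuous.
  by apply: cvgD; [apply: cvgM; [exact: cvg_cst|exact: cvg_id]|exact: cvg_cst].
rewrite (_ : w = g \o d).
  move=> x; apply: continuous_comp; last exact: cg.
  exact: continuous_signed_dist.
by apply/funext => x; rewrite /g /phase_field /=; congr ((1 + S _) / 2); ring.
Qed.

(** The maximum value 1 is attained there. Arguing by maximality includes the level d = -eps, around
    which the phase field need not be locally constant. *)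
Lemma gradient_phase_field_in x : d x <= - eps -> enorm (gradient w x) = 0.
Proof.
move=> dx; have w1 : w x = 1.
  rewrite /phase_field (profile_ge1 trS) ?divff//.
  by rewrite ler_pdivlMr// mul1r lerNr.
apply/eqP; rewrite eq_le enorm_ge0 andbT -(mulr0 n%:R).
apply: enorm_gradient_le => // j.
by rewrite partial_max ?normr0// => y; rewrite w1; exact: phase_field_le1.
Qed.

(** With q = S'(-d/eps), each partial derivative is at most 2q/eps, so the gradient is at most
    2nq/eps, and the difference quotient is at least qc/(4 eps). The ratio is 8n/c. The range [tau]
    may depend on x and eps, which is harmless since t tends to 0 afterwards. *)
Lemma gradient_phase_field_le x (e : 'rV[R]_n) (r c : R) :
  0 < r -> 0 < c -> `|d x| < eps ->
  (forall t, 0 <= t <= r -> d x + c * t <= d (x - t *: e)) ->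
  exists2 tau : R, 0 < tau & forall t, 0 < t < tau ->
    enorm (gradient w x) <= 8 * n%:R / c * ((w x - w (x - t *: e)) / t).
Proof.
move=> r0 c0 dx cone; pose s := - d x / eps.
have s1 : `|s| < 1.
  by rewrite normrM normrN normfV (gtr0_norm eps0) ltr_pdivrMr// mul1r.
have [q0 [del del0 Sq]] := profile_growth trS s1.
set q := derive1 S s in q0 Sq.
(* Only increments of d are bounded, as d need not be differentiable at x; a
  partial derivative of w that does not exist is 0. *)
have wle : enorm (gradient w x) <= n%:R * (2 * q / eps).
  (* A displacement h changes d by at most 2|h|, hence the argument of [S] by less than [del] in
     this range. *)
  have del20 : 0 < del * eps / 2 by rewrite divr_gt0// mulr_gt0.
  have M0 : 0 <= 2 * q / eps by rewrite divr_ge0 ?(ltW eps0)// mulr_ge0// ltW.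
  apply: enorm_gradient_le => // j; apply: (partial_bound M0 del20) => h hd.
  set y := h *: _ + x.
  have dyx : `|d y - d x| <= 2 * `|h|.
    apply: le_trans (signed_dist_lip y x D0 DC0) _.
    by rewrite /y addrK enormZ enorm_delta mulr1.
  have E : w y - w x = (S (- d y / eps) - S s) / 2.
    by rewrite /phase_field /s; lra.
  have sE : `|- d y / eps - s| = `|d y - d x| / eps.
    by rewrite /s -mulrBl -opprD normrM normrN normfV (gtr0_norm eps0); congr (`|_| / _); ring.
  have [|+ _] := Sq (- d y / eps).
    rewrite sE ltr_pdivrMr//; apply: le_lt_trans dyx _; lra.
  rewrite sE E normrM (gtr0_norm (_ : 0 < 2^-1))// => h1.
  rewrite ler_pdivrMr//; apply: le_trans h1 _.
  rewrite -!mulrA ler_wpM2l//.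
  have : q * (`|d y - d x| / eps) <= q * (2 * `|h| / eps).
    by rewrite (ler_wpM2l (ltW q0))// ler_wpM2r// invr_ge0 ltW.
  by move/le_trans; apply; rewrite le_eqVlt; apply/orP; left; apply/eqP; ring.
exists (Num.min r (del * eps / c)); first by rewrite lt_min r0 divr_gt0// mulr_gt0.
move=> t /andP[t0]; rewrite lt_min => /andP[tr td].
have tr' : 0 <= t <= r by rewrite (ltW t0) (ltW tr).
(* The cone bounds the argument of [S] only from one side; monotonicity moves it to s - ct/eps,
   whose distance to s is known, so that the lower growth bound applies. *)
have hs : S (- d (x - t *: e) / eps) <= S (s - c * t / eps).
  apply: profile_homo => //; rewrite /s -mulrBl ler_wpM2r ?invr_ge0 ?(ltW eps0)//.
  by have := cone t tr'; lra.
have ct0 : 0 < c * t / eps by rewrite divr_gt0// mulr_gt0.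
have nE : `|s - c * t / eps - s| = c * t / eps.
  by rewrite addrAC subrr add0r normrN gtr0_norm.
have [|_] := Sq (s - c * t / eps).
  by rewrite nE ltr_pdivrMr// mulrC -ltr_pdivlMr.
rewrite nE distrC ger0_norm; last first.
  by rewrite subr_ge0; apply: profile_homo => //; rewrite lerBlDr lerDl ltW.
move=> hq; apply: le_trans wle _.
have hw : q / 4 * (c * t / eps) <= w x - w (x - t *: e).
  by rewrite /phase_field -/s; lra.
have -> : n%:R * (2 * q / eps) = 8 * n%:R / c * (q / 4 * (c * t / eps) / t).
  by field; rewrite ?gt_eqF.
by rewrite ler_wpM2l ?divr_ge0 ?mulr_ge0 ?(ltW c0)// ler_wpM2r// invr_ge0 ltW.
Qed.

End phase_field_bounds.

(** * The local estimate *)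

(** Young's inequality for y and a^(p-1) with exponents p and p/(p-1), multiplied by p. The case p =
    1, without a finite conjugate exponent, is an equality. *)
Lemma powR_tangent (R : realType) (p a y : R) : 1 <= p -> 0 <= a -> 0 <= y ->
  p * a `^ (p - 1) * y <= (p - 1) * a `^ p + y `^ p.
Proof.
move=> p1 a0 y0; move: p1; rewrite le_eqVlt => /predU1P[<-|p1].
  by rewrite subrr powRr0 mul0r add0r mulr1 mul1r powRr1.
have p0 : 0 < p := lt_trans ltr01 p1.
have p10 : 0 < p - 1 by rewrite subr_gt0.
have q0 : 0 < p / (p - 1) by rewrite divr_gt0.
have pq : p^-1 + (p / (p - 1))^-1 = 1.
  by rewrite invf_div; field; rewrite ?gt_eqF.
have := conjugate_powR y0 (powR_ge0 a (p - 1)) p0 q0 pq.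
rewrite -powRrM (_ : (p - 1) * (p / (p - 1)) = p); last by field; rewrite gt_eqF.
move=> /(ler_wpM2l (ltW p0)) h.
rewrite -mulrA (mulrC (_ `^ _)); apply: le_trans h _.
rewrite le_eqVlt; apply/orP; left; apply/eqP.
by rewrite invf_div; field; rewrite ?gt_eqF.
Qed.

(** The tangent to the convex function x^p at a lies below its graph at b. *)
Lemma powR_sub_le (R : realType) (p a b : R) : 1 <= p -> 0 <= a -> 0 <= b ->
  a `^ p - b `^ p <= p * a `^ (p - 1) * (a - b).
Proof.
move=> p1 a0 b0; have h := powR_tangent p1 a0 b0.
have E : a `^ p = a `^ (p - 1) * a.
  have [->|a00] := eqVneq a 0.
    by rewrite mulr0 powR0// gt_eqF// (lt_le_trans ltr01).
  by rewrite -[X in _ = _ * X]powRr1// -powRD ?subrK// a00 implybT.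
by rewrite E in h *; lra.
Qed.

(** The rational boxes with closure in [V] are countably many and cover [V], so their exceptional
    null sets add up to a null set. *)
Lemma ae_open_obox (R : realType) n (V : set 'rV[R]_n) (P : 'rV[R]_n -> Prop) :
  open V ->
  (forall a b, cbox a b `<=` V -> {ae lebesgue_rV R n, forall x, obox a b x -> P x}) ->
  {ae lebesgue_rV R n, forall x, V x -> P x}.
Proof.
move=> oV aeP.
pose Q (k : nat) x := if @unpickle ('rV[rat]_n * 'rV[rat]_n)%type k is Some q then
  rat_cbox q `<=` V -> rat_obox q x -> P x else True.
have : {ae lebesgue_rV R n, forall x k, Q k x}.
  apply: ae_foralln => k; rewrite /Q; case: unpickle => [q|]; last exact: aeW.
  have [qV|qV] := pselect (rat_cbox (R := R) q `<=` V); last exact: aeW.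
  by apply: filterS (aeP _ _ qV) => x Px _.
apply: filterS => x Qx Vx; have := Vx; rewrite {1}(open_bigcup_obox oV) => -[q qV qx].
by have := Qx (pickle q); rewrite /Q pickleK; exact.
Qed.

Section local_estimate.
Context {R : realType} {n : nat}.
Local Notation mu := (lebesgue_rV R n).
Local Notation leb := (@lebesgue_measure R).
Variables (U : set 'rV[R]_n) (v w : 'rV[R]_n -> R) (g : 'rV[R]_n -> 'rV[R]_n).
Variables (p s rho : R) (i : 'I_n) (x0 : 'rV[R]_n).
Local Notation T := (fun r x => x + (s * r) *: (delta_mx ord0 i : 'rV[R]_n)).
Hypotheses (oU : open U) (wg : is_weak_gradient U v g).
Hypotheses (mw : measurable_fun setT w) (w0 : forall x, 0 <= w x).
Hypotheses (p1 : 1 <= p) (s1 : s ^+ 2 = 1) (rho0 : 0 < rho).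
Hypothesis TU : forall x t, `|x - x0| < rho -> 0 <= t <= rho -> U x -> U (T t x).
Hypothesis Tw : forall x t, `|x - x0| < rho -> 0 <= t <= rho -> w x <= w (T t x).

Definition tent (r : R) (x : 'rV[R]_n) : R := Num.max 0 (r - `|x - x0|).

(** The bound 1 keeps the cut-off at most 1; the bound rho / 2 keeps x - t e within rho of [x0] for
    t <= rho / 2. *)
Let kappa := Num.min 1 (rho / 2).
Local Notation phi := (tent kappa).
Let A x := `|(v \_ U) x| `^ p.
Let B x := `|((fun x => g x ord0 i) \_ U) x| `^ p.

Lemma tent_ge0 r x : 0 <= tent r x.
Proof. by rewrite le_max lexx. Qed.

Lemma tent_le r x : 0 <= r -> tent r x <= r.
Proof. by move=> r0; rewrite ge_max r0 lerBlDr lerDl normr_ge0. Qed.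

Lemma tent_neq0 r x : tent r x != 0 -> `|x - x0| < r.
Proof.
apply: contraNT; rewrite -leNgt => rx; apply/eqP/max_idPl.
by rewrite subr_le0.
Qed.

Lemma tent_lip r x y : tent r x <= tent r y + `|x - y|.
Proof.
rewrite ge_max addr_ge0 ?tent_ge0//=.
have : r - `|y - x0| <= tent r y by rewrite le_max lexx orbT.
have := ler_normD (y - x) (x - x0); rewrite subrKA (distrC y x) => h1 h2.
lra.
Qed.

Lemma measurable_tent r : measurable_fun setT (tent r).
Proof.
apply: continuous_measurable_rV => x.
apply/(@cvgrPdist_le _ _ _ _ (nbhs_filter x)) => eps eps0.
apply/nbhs_ballP; exists eps => //= y; rewrite -ball_normE /= => /ltW xy.
apply: le_trans xy; rewrite ler_norml; apply/andP; split.
  by have := tent_lip r y x; rewrite distrC; lra.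
by have := tent_lip r x y; lra.
Qed.

Let norm_s : `|s| = 1.
Proof. by apply/eqP; rewrite -(@eqrXn2 _ 2)// ?expr1n -?normrX ?s1 ?normr1. Qed.

Lemma norm_translate x t : 0 <= t -> `|T t x - x| <= t.
Proof.
move=> t0; rewrite addrAC subrr add0r normrZ normrM norm_s mul1r ger0_norm//.
rewrite ler_piMr//; apply: le_trans (norm_le_enorm _) _.
by rewrite enorm_delta.
Qed.

Let A_ge0 x : 0 <= A x. Proof. exact: powR_ge0. Qed.
Let B_ge0 x : 0 <= B x. Proof. exact: powR_ge0. Qed.

Let mU : measurable U. Proof. exact: open_measurable_rV. Qed.

Let mA : measurable_fun setT A.
Proof.
have [[mv _] _ _] := wg; have {}mv := (measurable_restrictT v mU).1 mv.
have mnv : measurable_fun setT (fun x => `|(v \_ U) x|) by exact: measurableT_comp.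
exact: (measurableT_comp (measurable_powR p) mnv).
Qed.

Let mgU : measurable_fun setT ((fun x => g x ord0 i) \_ U).
Proof.
have [_ /(_ i)[mg _] _] := wg.
exact: (measurable_restrictT (fun x => g x ord0 i) mU).1 mg.
Qed.

Let mB : measurable_fun setT B.
Proof.
have mng : measurable_fun setT (fun x => `|((fun x => g x ord0 i) \_ U) x|).
  exact: measurableT_comp.
exact: (measurableT_comp (measurable_powR p) mng).
Qed.

Let kappa_rho : kappa <= rho / 2. Proof. by rewrite ge_min lexx orbT. Qed.
Let kappa1 : kappa <= 1. Proof. by rewrite ge_min lexx. Qed.
Let kappa0 : 0 <= kappa. Proof. by rewrite le_min ler01 divr_ge0// ltW. Qed.

(** Convexity compares |v|^p at x and at T t x, the 1-Lipschitz cut-off costs a term with factor t,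
    and |v x| - |v (T t x)| is at most the integral of |g_i| along the segment. Young's inequality
    then separates v from g, and the monotonicity of [w] along the segment puts the weight at the
    right points. *)
Lemma local_pointwise t x : 0 < t <= rho / 2 -> U x -> `|x - x0| < kappa ->
  ((v (T t x) - v x)%:E =
    s%:E * \int[leb]_(r in `[0%R, t]) (g (T r x) ord0 i)%:E)%E ->
  ((A x * phi x * w x)%:E <= (A (T t x) * phi (T t x) * w x)%:E
    + (t * (A (T t x) * w (T t x)) + t * (p - 1) * (A x * w x))%:E
    + \int[leb]_(r in `[0%R, t]) (B (T r x) * w (T r x))%:E)%E.
Proof.
move=> /andP[t0 tr] Ux xk vE.
have xrho : `|x - x0| < rho by apply: lt_le_trans xk _; have := kappa_rho; lra.
have tU (r : R) : 0 <= r <= t -> U (T r x).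
  by move=> /andP[r0 rt]; apply: TU => //; rewrite r0/=; lra.
have tw (r : R) : 0 <= r <= t -> w x <= w (T r x).
  by move=> /andP[r0 rt]; apply: Tw => //; rewrite r0/=; lra.
have tt : 0 <= t <= t by rewrite lexx ltW.
have AE y : U y -> A y = `|v y| `^ p by move=> Uy; rewrite /A patchE mem_set.
have BE y : U y -> B y = `|g y ord0 i| `^ p by move=> Uy; rewrite /B patchE mem_set.
set J := (\int[leb]_(r in _) (B _ * _)%:E)%E.
pose a := `|v x|; pose b := `|v (T t x)|.
have phi0 := tent_ge0 kappa x.
have phi1 : phi x <= 1 := le_trans (tent_le x kappa0) kappa1.
pose m := p * a `^ (p - 1) * (phi x * w x).
have p0 : 0 <= p := le_trans ler01 p1.
have m0 : 0 <= m by rewrite !mulr_ge0// powR_ge0.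
pose gU := (fun x => g x ord0 i) \_ U.
have mTr : measurable_fun [set: R] (fun r => T r x).
  apply: measurable_fun_rV => j.
  apply: (eq_measurable_fun
      (fun r => x ord0 j + s * r * (delta_mx ord0 i : 'rV[R]_n) ord0 j)).
    by move=> r _; rewrite !mxE.
  by apply: measurable_funD => //; apply: measurable_funM => //; apply: measurable_funM.
have mgT : measurable_fun [set: R] (fun r => gU (T r x)).
  exact: (measurableT_comp mgU mTr).
have mngT : measurable_fun [set: R] (fun r => `|gU (T r x)|).
  exact: measurableT_comp.
have mBT : measurable_fun [set: R] (fun r => B (T r x) * w (T r x)).
  by apply: measurable_funM;
    [exact: (measurableT_comp mB mTr)|exact: (measurableT_comp mw mTr)].
(* Since m >= 0 it can be moved under the integral, where Young's inequality, phi <= 1 and w x <= w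
   (T r x) apply for each r. *)
have key : ((m * (a - b))%:E <= (t * (p - 1) * (A x * w x))%:E + J)%E.
  have h1 : ((a - b)%:E <= \int[leb]_(r in `[0%R, t]) (`|gU (T r x)|)%:E)%E.
    have intE : (\int[leb]_(r in `[0%R, t]) (g (T r x) ord0 i)%:E =
        \int[leb]_(r in `[0%R, t]) (gU (T r x))%:E)%E.
      apply: eq_integral => r; rewrite inE/= in_itv/= => rt.
      by rewrite /gU patchE mem_set//; exact: tU.
    apply: (@le_trans _ _ `|(v (T t x) - v x)%:E|%E).
      by rewrite lee_fin /a /b distrC; exact: lerB_dist.
    rewrite vE intE abseM/= norm_s mul1e.
    apply: le_abse_integral => //.
    by apply/measurable_EFinP; exact: measurable_funTS mgT.
  rewrite EFinM; apply: le_trans (lee_wpmul2l _ h1) _; first by rewrite lee_fin.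
  rewrite -ge0_integralZl_EFin//; last first.
    by apply/measurable_EFinP; exact: measurable_funTS mngT.
  apply: (@le_trans _ _ (\int[leb]_(r in `[0%R, t])
      (((p - 1) * (A x * w x))%:E + (B (T r x) * w (T r x))%:E))%E).
    apply: le_lower_integral.
    - by move=> r _; rewrite -EFinM lee_fin mulr_ge0.
    - move=> r; rewrite /= in_itv/= => rt; rewrite -EFinM -EFinD lee_fin.
      rewrite AE// /B -/gU.
      have := powR_tangent p1 (normr_ge0 (v x)) (normr_ge0 (gU (T r x))).
      rewrite -/a; set G := `|_|; set ap := a `^ p; set Gp := G `^ p => h.
      have G0 : 0 <= Gp := powR_ge0 _ _.
      have a0 : 0 <= ap := powR_ge0 _ _.
      have pw0 : 0 <= phi x * w x by rewrite mulr_ge0.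
      have e1 := ler_wpM2l pw0 h.
      have pap : 0 <= (p - 1) * ap + Gp by rewrite addr_ge0// mulr_ge0// subr_ge0.
      have e2 : phi x * w x * ((p - 1) * ap + Gp) <= w x * ((p - 1) * ap + Gp).
        by rewrite ler_wpM2r// ler_piMl.
      have e3 : Gp * w x <= Gp * w (T r x) by rewrite ler_wpM2l// tw.
      by rewrite /m; lra.
  rewrite ge0_integralD//; last 3 first.
  - by move=> r _; rewrite lee_fin !mulr_ge0// subr_ge0.
  - by move=> r _; rewrite lee_fin mulr_ge0.
  - by apply/measurable_EFinP; exact: measurable_funTS mBT.
  rewrite integral_cst//=.
  have -> : (leb `[0%R, t]%classic = t%:E)%E.
    by rewrite lebesgue_measure_itv/= lte_fin t0 sube0.
  by rewrite leeD2r// -EFinM lee_fin; lra.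
(* Convexity at x, then phi x <= phi (T t x) + t; the term with factor t is small enough to carry
   the larger weight w (T t x). *)
have pw : A x * phi x * w x <= A (T t x) * phi (T t x) * w x +
    t * (A (T t x) * w (T t x)) + m * (a - b).
  rewrite AE// AE; last exact: tU. 
  rewrite -/a -/b.
  have h1 := powR_sub_le p1 (normr_ge0 (v x)) (normr_ge0 (v (T t x))).
  have h2 : phi x <= phi (T t x) + t.
    apply: le_trans (tent_lip kappa x (T t x)) _; rewrite lerD2l distrC.
    by apply: norm_translate; exact: ltW.
  have h3 := tw t tt.
  have b0 : 0 <= b `^ p := powR_ge0 _ _.
  have pw0 : 0 <= phi x * w x by rewrite mulr_ge0.
  have e1 := ler_wpM2l pw0 h1.
  have e2 : b `^ p * w x * phi x <= b `^ p * w x * (phi (T t x) + t).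
    by rewrite ler_wpM2l// mulr_ge0.
  have e3 : t * b `^ p * w x <= t * b `^ p * w (T t x).
    by rewrite ler_wpM2l// mulr_ge0// ltW.
  rewrite -/a -/b in e1.
  by rewrite /m; lra.
apply: (@le_trans _ _ ((A (T t x) * phi (T t x) * w x +
    t * (A (T t x) * w (T t x)))%:E + (m * (a - b))%:E)%E).
  by rewrite -EFinD lee_fin.
apply: le_trans (leeD2l _ key) _.
by rewrite addeA -!EFinD !addrA.
Qed.

Let J t x := (\int[leb]_(r in `[0%R, t]) (B (T r x) * w (T r x))%:E)%E.

Let mBw : measurable_fun setT (fun x => B x * w x).
Proof. exact: measurable_funM. Qed.

Let mAw : measurable_fun setT (fun x => A x * w x).
Proof. exact: measurable_funM. Qed.

Let segment_graph_ge0 t z :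
  (0 <= segment_graph (delta_mx ord0 i) s t (fun x => B x * w x)%R z)%E.
Proof. by rewrite lee_fin mulr_ge0// mulr_ge0. Qed.

Let mJ t : measurable_fun setT (J t).
Proof.
rewrite (_ : J t = fun x => \int[leb]_r
    segment_graph (delta_mx ord0 i) s t (fun x => B x * w x)%R (r, x))%E.
  have mS := measurable_segment_graph (delta_mx ord0 i) s t mBw.
  exact: (measurable_fun_fubini_tonelli_G (m1 := leb) _ mS (segment_graph_ge0 t)).
by apply/funext => x; rewrite integral_segment_graph.
Qed.

Let J_ge0 t x : (0 <= J t x)%E.
Proof. by apply: integral_ge0 => r _; rewrite lee_fin mulr_ge0. Qed.

(** Tonelli's theorem with translation invariance in x at each fixed r; the integral on the right
    may be infinite. *)
Lemma integral_segment_weight t : 0 < t ->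
  (\int[mu]_x J t x = t%:E * \int[mu]_x (B x * w x)%:E)%E.
Proof.
move=> t0; transitivity (\int[mu]_x \int[leb]_r
    segment_graph (delta_mx ord0 i) s t (fun x => B x * w x)%R (r, x))%E.
  by apply: eq_integral => x _; rewrite integral_segment_graph.
have mS := measurable_segment_graph (delta_mx ord0 i) s t mBw.
have FT := fubini_tonelli (m1 := leb) (m2 := mu) _ mS (segment_graph_ge0 t).
apply: etrans (esym FT) _.
under eq_integral => r _.
  have -> : (\int[mu]_x segment_graph (delta_mx ord0 i) s t (fun x => B x * w x)%R (r, x)
     = (\1_(`[0%R, t]%classic : set R) r)%:E * \int[mu]_x (B x * w x)%:E)%E.
    rewrite -(ge0_integral_translation ((s * r) *: delta_mx ord0 i)
      (f := fun x => (B x * w x)%:E)) //; last 2 first.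
    - exact/measurable_EFinP.
    - by move=> x; rewrite lee_fin mulr_ge0.
    rewrite -ge0_integralZl_EFin//.
    - by move=> x _; rewrite lee_fin mulr_ge0.
    - apply/measurable_EFinP; apply: (measurableT_comp mBw).
      exact: measurable_translation.
  over.
rewrite ge0_integralZr//; last 2 first.
- by apply/measurable_EFinP; exact: measurable_indic.
- by apply: integral_ge0 => x _; rewrite lee_fin mulr_ge0.
congr (_ * _)%E.
have -> : (\int[leb]_r (\1_(`[0%R, t]%classic : set R) r)%:E = leb `[0%R, t]%classic)%E.
  by rewrite integral_indic// setIT.
by rewrite lebesgue_measure_itv/= lte_fin t0 sube0.
Qed.

Lemma ae_local_pointwise t : 0 < t <= rho / 2 -> {ae mu, forall x,
  ((A x * phi x * w x)%:E <= (A (T t x) * phi (T t x) * w x)%:E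
    + (t * (A (T t x) * w (T t x)) + t * (p - 1) * (A x * w x))%:E + J t x)%E}.
Proof.
move=> tr; have /andP[t0 t1] := tr.
pose V := U `&` ball x0 kappa.
have oV : open V by apply: openI => //; exact: ball_open.
have Vk x : V x -> `|x - x0| < kappa.
  by move=> [_]; rewrite -ball_normE /= distrC.
have : {ae mu, forall x, V x -> (v (T t x) - v x)%:E =
    (s%:E * \int[leb]_(r in `[0%R, t]) (g (T r x) ord0 i)%:E)%E}.
  apply: ae_open_obox => // a b abV; apply: (weak_translation s1 t0 oU wg).
  move=> x r /abV Vx /andP[r0 rt]; apply: TU; last by case: Vx.
    by have := Vk x Vx; have := kappa_rho; lra.
  by rewrite r0/=; lra.
apply: filterS => x Px.
have [Vx|nVx] := pselect (V x).
  by apply: local_pointwise => //; [case: Vx|exact: Vk|exact: Px].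
(* Off [U] or off the ball the left side is 0, by the extension by zero or the cut-off, and the
   right side is nonnegative. *)
rewrite (_ : A x * phi x * w x = 0).
  rewrite adde_ge0// -EFinD lee_fin !addr_ge0 ?mulr_ge0// ?tent_ge0//; try exact: ltW.
  by rewrite subr_ge0.
have [Ux|nUx] := pselect (U x); last first.
  by rewrite /A patchE memNset// normr0 powR0 ?mul0r// gt_eqF// (lt_le_trans ltr01).
rewrite (_ : phi x = 0) ?mulr0 ?mul0r//.
apply/eqP; apply: contra_notT nVx => /tent_neq0 xk; split => //.
by rewrite -ball_normE /= distrC.
Qed.

Lemma increment_ge0 a t x : 0 <= a -> 0 < t <= rho / 2 ->
  0 <= a * phi x * (w x - w (x - (s * t) *: delta_mx ord0 i)).
Proof.
move=> a0 /andP[t0 t1]; have [->|/tent_neq0 xk] := eqVneq (phi x) 0.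
  by rewrite mulr0 mul0r.
pose y := x - (s * t) *: (delta_mx ord0 i : 'rV[R]_n).
have Ty : T t y = x by rewrite /y subrK.
rewrite !mulr_ge0// ?tent_ge0// subr_ge0 -/y -[X in _ <= w X]Ty.
apply: Tw; last by rewrite (ltW t0)/=; lra.
have := norm_translate y (ltW t0); rewrite /= Ty => h.
have := ler_normD (y - x) (x - x0); rewrite subrKA (distrC y x).
by have := kappa_rho; lra.
Qed.

(** A discrete integration by parts: translation turns the integral of A phi w(x - t e) into that of
    (A phi)(x + t e) w(x), to which the pointwise bound is compared. The coefficient p is 1, from
    the variation of the cut-off, plus p - 1, from Young's inequality. *)
Lemma local_estimate t : 0 < t <= rho / 2 ->
  (\int[mu]_x (A x * w x)%:E < +oo)%E ->
  (\int[mu]_x (A x * phi x * (w x - w (x - (s * t) *: delta_mx ord0 i)))%:E <=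
   t%:E * (p%:E * \int[mu]_x (A x * w x)%:E + \int[mu]_x (B x * w x)%:E))%E.
Proof.
move=> tr Aoo; have /andP[t0 t1] := tr.
set a := (\int[mu]_x (A x * w x)%:E)%E in Aoo *.
set b := (\int[mu]_x (B x * w x)%:E)%E.
pose y x := x - (s * t) *: (delta_mx ord0 i : 'rV[R]_n).
have Ty x : T t (y x) = x by rewrite /y subrK.
have mTt : measurable_fun setT (T t) by exact: measurable_translation.
have my : measurable_fun setT y by exact: measurable_translation.
pose F2 x := (A x * phi x * w (y x))%:E.
pose F3 x := (A x * phi x * (w x - w (y x)))%:E.
have mphi := measurable_tent kappa.
have mAphi : measurable_fun setT (fun x => A x * phi x) by exact: measurable_funM.
have mF2 : measurable_fun setT F2.
  apply/measurable_EFinP; apply: measurable_funM => //.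
  exact: (measurableT_comp mw my).
have mF3 : measurable_fun setT F3.
  apply/measurable_EFinP; apply: measurable_funM => //; apply: measurable_funB => //.
  exact: (measurableT_comp mw my).
have Aphi0 x : 0 <= A x * phi x by rewrite mulr_ge0// tent_ge0.
have F20 x : (0 <= F2 x)%E by rewrite lee_fin mulr_ge0.
have F30 x : (0 <= F3 x)%E by rewrite lee_fin increment_ge0.
have F1E : (\int[mu]_x (A x * phi x * w x)%:E = \int[mu]_x F2 x + \int[mu]_x F3 x)%E.
  rewrite -ge0_integralD//; apply: eq_integral => x _.
  by rewrite /F2 /F3 -EFinD; congr _%:E; ring.
have F2fin : (\int[mu]_x F2 x \is a fin_num)%E.
  rewrite ge0_fin_numE ?integral_ge0//; apply: le_lt_trans Aoo.
  apply: (@le_trans _ _ (\int[mu]_x (A x * phi x * w x)%:E)%E).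
    by rewrite F1E leeDl// integral_ge0.
  apply: le_lower_integral => x _; first by rewrite lee_fin mulr_ge0.
  rewrite lee_fin ler_wpM2r// ler_piMr//.
  exact: le_trans (tent_le x kappa0) kappa1.
have F2T : (\int[mu]_x F2 x = \int[mu]_x (A (T t x) * phi (T t x) * w x)%:E)%E.
  rewrite -(ge0_integral_translation ((s * t) *: delta_mx ord0 i) mF2)//.
  by apply: eq_integral => x _; rewrite /F2 /y addrK.
have mAT : measurable_fun setT (fun x => A (T t x) * w (T t x)).
  exact: (measurableT_comp mAw mTt).
(* The translated term is added to both sides; cancelling it again is legitimate because it is
   finite, by the finiteness of the integral of A w. *)
rewrite -[leLHS]/(\int[mu]_x F3 x)%E -(leeD2lE _ _ F2fin) -F1E.
have mG2 : measurable_fun setT (fun x => (A (T t x) * phi (T t x) * w x)%:E).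
  apply/measurable_EFinP; apply: measurable_funM => //.
  exact: (measurableT_comp mAphi mTt).
have mG3 : measurable_fun setT (fun x => (t * (A (T t x) * w (T t x)) +
    t * (p - 1) * (A x * w x))%:E).
  apply/measurable_EFinP; apply: measurable_funD; apply: measurable_funM => //.
have G20 x : (0 <= (A (T t x) * phi (T t x) * w x)%:E)%E.
  by rewrite lee_fin mulr_ge0.
have tp0 : 0 <= t * (p - 1) by rewrite mulr_ge0 ?(ltW t0)// subr_ge0.
have G30 x : (0 <= (t * (A (T t x) * w (T t x)) + t * (p - 1) * (A x * w x))%:E)%E.
  by rewrite lee_fin addr_ge0// mulr_ge0 ?(ltW t0)// mulr_ge0.
have mG23 : measurable_fun setT (fun x => (A (T t x) * phi (T t x) * w x)%:E +
    (t * (A (T t x) * w (T t x)) + t * (p - 1) * (A x * w x))%:E)%E.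
  exact: emeasurable_funD.
apply: (@le_trans _ _ (\int[mu]_x ((A (T t x) * phi (T t x) * w x)%:E +
    (t * (A (T t x) * w (T t x)) + t * (p - 1) * (A x * w x))%:E + J t x))%E).
  apply: ae_ge0_le_integral.
  - by [].
  - by move=> x _; rewrite lee_fin mulr_ge0.
  - by apply/measurable_EFinP; exact: measurable_funM.
  - by move=> x _; apply: adde_ge0; [exact: adde_ge0|exact: J_ge0].
  - by apply: emeasurable_funD => //; exact: mJ.
  - by apply: filterS (ae_local_pointwise tr) => x h _; exact: h.
have G230 x : (0 <= (A (T t x) * phi (T t x) * w x)%:E +
    (t * (A (T t x) * w (T t x)) + t * (p - 1) * (A x * w x))%:E)%E.
  exact: adde_ge0.
rewrite (ge0_integralD mu measurableT (fun x _ => G230 x) mG23 (fun x _ => J_ge0 t x) (mJ t)).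
rewrite (ge0_integralD mu measurableT (fun x _ => G20 x) mG2 (fun x _ => G30 x) mG3).
rewrite -F2T integral_segment_weight// -addeA leeD2l//.
have a0 : (0 <= a)%E by apply: integral_ge0 => x _; rewrite lee_fin mulr_ge0.
have afin : (a \is a fin_num)%E by rewrite ge0_fin_numE.
have pE : (0 <= p%:E)%E by rewrite lee_fin (le_trans ler01 p1).
have b0 : (0 <= b)%E by apply: integral_ge0 => x _; rewrite lee_fin mulr_ge0.
rewrite (ge0_muleDr _ (mule_ge0 pE a0) b0).
rewrite leeD2r//.
have -> : (\int[mu]_x (t * (A (T t x) * w (T t x)) + t * (p - 1) * (A x * w x))%:E =
    t%:E * a + (t * (p - 1))%:E * a)%E.
  have f1 x : (0 <= (A (T t x) * w (T t x))%:E)%E by rewrite lee_fin mulr_ge0.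
  have f2 x : (0 <= (A x * w x)%:E)%E by rewrite lee_fin mulr_ge0.
  have mf1 : measurable_fun setT (fun x => (A (T t x) * w (T t x))%:E).
    exact/measurable_EFinP.
  have mf2 : measurable_fun setT (fun x => (A x * w x)%:E) by exact/measurable_EFinP.
  transitivity (\int[mu]_x (t%:E * (A (T t x) * w (T t x))%:E +
      (t * (p - 1))%:E * (A x * w x)%:E))%E; first by apply: eq_integral.
  rewrite ge0_integralD//; last 4 first.
  - by move=> x _; rewrite mule_ge0// lee_fin ltW.
  - exact: measurable_funeM.
  - by move=> x _; rewrite mule_ge0// lee_fin.
  - exact: measurable_funeM.
  rewrite !ge0_integralZl_EFin//; last exact: ltW.
  have ET : (\int[mu]_x (A (T t x) * w (T t x))%:E = a)%E.
    exact: (ge0_integral_translation ((s * t) *: delta_mx ord0 i) mf2 f2).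
  by rewrite ET.
rewrite -(fineK afin) -!EFinM -EFinD lee_fin le_eqVlt; apply/orP; left; apply/eqP; ring.
Qed.

End local_estimate.

(** * Covering the boundary *)

Section boundary_layer.
Context {R : realType} {n : nat}.
Implicit Types (D : set 'rV[R]_n.+1) (x : 'rV[R]_n.+1).

Definition boundary D := closure D `\` interior D.

Lemma setC_nonempty D : bounded_set D -> ~` D !=set0.
Proof.
move=> [M [_ DM]]; exists (const_mx (`|M| + 2)) => Dx.
have MM : M < `|M| + 1 by have := ler_norm M; lra.
have := DM _ MM _ Dx; apply/negP; rewrite -ltNge.
apply: lt_le_trans (norm_coord_le _ ord0); rewrite mxE [X in _ < X]ger0_norm ?addr_ge0//.
by have := normr_ge0 M; lra.
Qed.

Lemma compact_boundary D : bounded_set D -> compact (boundary D).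
Proof.
move=> [M [_ DM]]; apply: bounded_closed_compact.
  exists (`|M| + 1); split; first by rewrite num_real.
  move=> K MK x [clx _]; apply: le_trans (ltW MK).
  apply/ler_addgt0Pl => e e0; have [y [Dy]] := clx _ (nbhsx_ballx x _ e0).
  rewrite -ball_normE /= => xy.
  have MM : M < `|M| + 1 by have := ler_norm M; lra.
  have := DM _ MM _ Dy; have := ler_normD (x - y) y; rewrite subrK/= => h1 h2.
  lra.
apply: closedI; first exact: closed_closure.
by apply: open_closedC; exact: open_interior.
Qed.

Lemma signed_dist_lt0 D x : open D -> ~` D !=set0 -> D x -> signed_dist D x < 0.
Proof.
move=> oD DC0 Dx; rewrite /signed_dist (dist_mem Dx) sub0r oppr_lt0.
have /nbhs_ballP[e /= e0 eD] : nbhs x D by exact: open_nbhs_nbhs.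
apply: lt_le_trans e0 _; apply: le_dist => // y Dy.
rewrite leNgt; apply/negP => xy; apply: Dy; apply: eD.
by rewrite -ball_normE /=; exact: le_lt_trans (norm_le_enorm _) xy.
Qed.

Lemma signed_dist_eq0 D x : open D -> D !=set0 -> ~` D !=set0 ->
  signed_dist D x = 0 -> boundary D x.
Proof.
move=> oD D0 DC0 dx; have nDx : ~ D x.
  by move=> /(signed_dist_lt0 oD DC0); rewrite dx ltxx.
split; last by move=> /interior_subset.
move=> B /nbhs_ballP[e /= e0 eB]; have dxe : dist x D < e.
  by move: dx; rewrite /signed_dist (dist_mem (A := ~` D) nDx) subr0 => ->.
have [y Dy xy] := dist_lt D0 dxe; exists y; split => //; apply: eB.
by rewrite -ball_normE /=; exact: le_lt_trans (norm_le_enorm _) xy.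
Qed.

(** The signed distance is continuous along the segment, negative at x and nonnegative at y, so the
    intermediate value theorem gives a zero of it. *)
Lemma boundary_crossing D x y : open D -> D x -> ~ D y ->
  exists2 r : R, 0 <= r <= 1 & boundary D (x + r *: (y - x)).
Proof.
move=> oD Dx nDy; have D0 : D !=set0 by exists x.
have DC0 : ~` D !=set0 by exists y.
pose f (r : R) := signed_dist D (x + r *: (y - x)).
have cf : {within `[0, 1], continuous f}.
  apply: continuous_subspaceT => r.
  apply: (@continuous_comp _ _ _ (fun r : R => x + r *: (y - x)) (signed_dist D)).
    2: exact: continuous_signed_dist.
  apply: cvgD; first exact: cvg_cst.
  by apply: cvgZr_tmp; exact: cvg_id.
have f0 : f 0 < 0 by rewrite /f scale0r addr0; exact: signed_dist_lt0.
have f1 : 0 <= f 1.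
  rewrite /f scale1r addrC subrK /signed_dist (dist_mem (A := ~` D) nDy) subr0.
  exact: dist_ge0.
have [|r] := @IVT R f 0 1 0 ler01 cf.
  by rewrite ge_min (ltW f0) le_max f1 orbT.
rewrite in_itv/= => r01 fr; exists r => //.
exact: signed_dist_eq0.
Qed.

(** Some point on the other side of the boundary is closer than [eta]; the segment to it crosses the
    boundary at a point that is closer still. *)
Lemma boundary_near D x (eta : R) : open D -> D !=set0 -> ~` D !=set0 ->
  `|signed_dist D x| < eta -> exists2 z, boundary D z & `|x - z| < eta.
Proof.
move=> oD D0 DC0 dx; have [Dx|Dx] := pselect (D x).
  have [|y Dy xy] := @dist_lt _ _ (~` D) x eta DC0.
    move: dx; rewrite /signed_dist (dist_mem Dx) sub0r normrN.
    by apply: le_lt_trans; rewrite ler_norm.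
  have [r /andP[r0 r1] bz] := boundary_crossing oD Dx Dy; exists (x + r *: (y - x)) => //.
  rewrite opprD addrA subrr sub0r normrN normrZ ger0_norm//.
  apply: le_lt_trans (_ : `|y - x| < _); first by rewrite ler_piMl.
  by rewrite distrC; exact: le_lt_trans (norm_le_enorm _) xy.
have [|y Dy xy] := @dist_lt _ _ D x eta D0.
  move: dx; rewrite /signed_dist (dist_mem (A := ~` D) Dx) subr0.
  by apply: le_lt_trans; rewrite ler_norm.
have [r /andP[r0 r1] bz] := boundary_crossing oD Dy Dx; exists (y + r *: (x - y)) => //.
rewrite (_ : x - (y + r *: (x - y)) = (1 - r) *: (x - y)); last first.
  by apply/rowP => j; rewrite !mxE; ring.
rewrite normrZ ger0_norm ?subr_ge0//.
apply: le_lt_trans (_ : `|x - y| < _).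
  by rewrite ler_piMl// lerBlDr lerDl.
exact: le_lt_trans (norm_le_enorm _) xy.
Qed.

Lemma boundary_finite_cover D (rad : 'rV[R]_n.+1 -> R) : bounded_set D ->
  (forall z, boundary D z -> 0 < rad z) ->
  exists2 l : seq 'rV[R]_n.+1, {in l, forall z, boundary D z} &
    forall z, boundary D z -> exists2 y, y \in l & `|z - y| < rad y.
Proof.
move=> /compact_boundary; rewrite compact_cover => cpt rad0.
have [|z Dz|l lD cov] := cpt _ (boundary D) (fun z => ball z (rad z)).
- by move=> z _; exact: ball_open.
- by exists z => //; apply: ballxx; exact: rad0.
exists (finmap.enum_fset l).
  by move=> z /lD; rewrite inE.
move=> z /cov[y /= yl]; rewrite -ball_normE /= distrC => zy.
by exists y.
Qed.

(** The radius r / 4 matches the factor 4 in [signed_dist_cone], and the division by n + 1 passes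
    from the Euclidean norm to the sup norm. *)
Lemma boundary_chart D x0 : open D -> D !=set0 -> C11_boundary D -> boundary D x0 ->
  exists i s (rho c : R), [/\ s ^+ 2 = 1, 0 < rho, 0 < c &
    forall x t, `|x - x0| < rho -> 0 <= t <= rho ->
      signed_dist D (x + (s * t) *: delta_mx ord0 i) <= signed_dist D x - c * t].
Proof.
move=> oD D0 C11 bx0; have [i [s [r [c [s1 r0 c0 cone]]]]] := boundary_cone C11 bx0.
have n0 : 0 < n.+1%:R :> R by rewrite ltr0Sn.
have r40 : 0 < r / 4 by rewrite divr_gt0.
exists i, s, (r / 4 / n.+1%:R), c; split => //; first exact: divr_gt0.
move=> x t xr /andP[t0 tr].
have -> : (s * t) *: delta_mx ord0 i = t *: (s *: delta_mx ord0 i) :> 'rV[R]_n.+1.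
  by rewrite scalerA mulrC.
apply: (@signed_dist_cone _ _ _ x0 (r / 4)) => //.
- rewrite enormZ enorm_delta mulr1; apply/eqP.
  by rewrite -(@eqrXn2 _ 2)// ?expr1n -?normrX ?s1 ?normr1.
- by case: bx0.
- by case: bx0 => _ + Dx0; apply; exact: open_nbhs_nbhs.
- by rewrite mulrC divfK.
- apply: le_lt_trans (enorm_le_norm _) _.
  by rewrite mulrC -ltr_pdivlMr.
- rewrite t0/=; apply: le_trans tr _; rewrite ler_pdivrMr// ler_peMr ?(ltW r40)//.
  by rewrite ler1n.
Qed.

End boundary_layer.

(** * Passage to the limit in the difference quotients *)

Section limn_einf_bounds.
Context {R : realType}.
Implicit Types (u : (\bar R)^nat) (c : \bar R).
Local Open Scope ereal_scope.

Lemma limn_einf_supE u : limn_einf u = ereal_sup (range (einfs u)).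
Proof. by rewrite limn_einf_lim; apply/cvg_lim => //; exact: cvg_einfs_sup. Qed.

Lemma limn_einf_ge u c N : (forall m, (N <= m)%N -> c <= u m) -> c <= limn_einf u.
Proof.
move=> h; rewrite limn_einf_supE; apply: (@le_trans _ _ (einfs u N)).
  by apply: le_ereal_inf_tmp => _ [m /= Nm <-]; exact: h.
by apply: ereal_sup_ubound; exists N.
Qed.

Lemma limn_einf_le u c : (forall m, u m <= c) -> limn_einf u <= c.
Proof.
move=> h; rewrite limn_einf_supE; apply: ge_ereal_sup => _ [m _ <-].
by apply: le_trans (h m); apply: ereal_inf_lbound; exists m => /=.
Qed.

End limn_einf_bounds.

(** For p = 0 the extension by zero would contribute outside [U], as 0 to the power 0 is 1. *)
Lemma integral_powR_patch {R : realType} {n : nat} (U : set 'rV[R]_n)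
    (f w : 'rV[R]_n -> R) (p : R) : p != 0 ->
  (\int[lebesgue_rV R n]_x (`|(f \_ U) x| `^ p * w x)%:E =
   \int[lebesgue_rV R n]_(x in U) (`|f x| `^ p * w x)%:E)%E.
Proof.
move=> p0; rewrite [RHS]integral_mkcond; apply: eq_integral => x _.
by rewrite !patchE; case: ifP => //; rewrite normr0 powR0// mul0r.
Qed.

Section local_liminf.
Context {R : realType} {n : nat}.
Local Notation mu := (lebesgue_rV R n).
Variables (U : set 'rV[R]_n) (v w : 'rV[R]_n -> R) (p s rho : R).
Variables (i : 'I_n) (x0 : 'rV[R]_n).
Hypotheses (oU : open U) (W1p : weighted_W1p p U w v).
Hypotheses (mw : measurable_fun setT w) (w0 : forall x, 0 <= w x).
Hypotheses (p1 : 1 <= p) (s1 : s ^+ 2 = 1) (rho0 : 0 < rho).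
Hypothesis TU : forall x t, `|x - x0| < rho -> 0 <= t <= rho ->
  U x -> U (x + (s * t) *: delta_mx ord0 i).
Hypothesis Tw : forall x t, `|x - x0| < rho -> 0 <= t <= rho ->
  w x <= w (x + (s * t) *: delta_mx ord0 i).
Local Notation kappa := (Num.min 1 (rho / 2)).

(** The function [G] is a measurable substitute for |v|^p |grad w| near [x0]. The number [L] stands
    for a multiple of |grad w| at one point, so neither the limit of the difference quotients nor a
    measurable gradient is required. *)
Lemma local_liminf : exists G : 'rV[R]_n -> \bar R, [/\ measurable_fun setT G,
    (forall x, 0 <= G x)%E,
    (\int[mu]_x G x <= (p + 1)%:E * weighted_W1p_normp p U w v)%E &
    forall x L tau, U x -> `|x - x0| < kappa / 2 -> 0 < tau -> 0 <= L ->
      (forall t, 0 < t < tau ->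
        L <= (w x - w (x - (s * t) *: delta_mx ord0 i)) / t) ->
      ((`|v x| `^ p * (L * (kappa / 2)))%:E <= G x)%E].
Proof.
have [exg [mv vLp] gLp] := W1p.
pose g := weak_gradient U v.
have wg : is_weak_gradient U v g by apply: (xgetPex (fun=> 0)) exg.
have mU := open_measurable_rV oU.
have rho20 : 0 < rho / 2 by rewrite divr_gt0.
have kappa0 : 0 < kappa by rewrite lt_min ltr01 rho20.
have p0 : 0 < p := lt_le_trans ltr01 p1.
have pN0 : p != 0 by rewrite gt_eqF.
pose A x := `|(v \_ U) x| `^ p.
pose B x := `|((fun x => g x ord0 i) \_ U) x| `^ p.
set N := weighted_W1p_normp _ _ _ _.
have AN : (\int[mu]_x (A x * w x)%:E <= N)%E /\ (\int[mu]_x (B x * w x)%:E <= N)%E.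
  rewrite !integral_powR_patch//; split; apply: le_lower_integral => x _.
  - by rewrite lee_fin mulr_ge0// powR_ge0.
  - by rewrite lee_fin ler_wpM2r// lerDl powR_ge0.
  - by rewrite lee_fin mulr_ge0// powR_ge0.
  rewrite lee_fin ler_wpM2r//; apply: le_trans (_ : enorm (g x) `^ p <= _).
    by apply: ge0_ler_powR; rewrite ?nnegrE ?enorm_ge0 ?coord_le_enorm// ltW.
  by rewrite lerDr powR_ge0.
pose tau (m : nat) := rho / 2 / m.+1%:R.
have tau0 m : 0 < tau m by rewrite divr_gt0.
have taur m : 0 < tau m <= rho / 2.
  by rewrite tau0 ler_pdivrMr// ler_peMr ?(ltW rho20)// ler1n.
pose F m x := ((tau m)^-1 * (A x * tent x0 kappa x *
  (w x - w (x - (s * tau m) *: delta_mx ord0 i))))%:E.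
have A0 x : 0 <= A x := powR_ge0 _ _.
have F0 m x : (0 <= F m x)%E.
  rewrite lee_fin mulr_ge0//; first by rewrite invr_ge0 ltW.
  exact: (increment_ge0 s1 Tw).
have mA : measurable_fun setT A.
  have mvU := (measurable_restrictT v mU).1 mv.
  have mnv : measurable_fun setT (fun x => `|(v \_ U) x|) by exact: measurableT_comp.
  exact: (measurableT_comp (measurable_powR p) mnv).
have mF0 m : measurable_fun setT (fun x => A x * tent x0 kappa x *
    (w x - w (x - (s * tau m) *: delta_mx ord0 i))).
  apply: measurable_funM; first by apply: measurable_funM => //; exact: measurable_tent.
  apply: measurable_funB => //; apply: (measurableT_comp mw).
  exact: measurable_translation.
have mF m : measurable_fun setT (F m).
  by apply/measurable_EFinP; apply: measurable_funM.
(* Fatou's lemma bounds the integral of this lower limit, since each F m satisfies the local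
   estimate divided by tau m, uniformly in m. *)
exists (fun x => limn_einf (F^~ x)); split.
- rewrite /limn_einf; apply: measurableT_comp => //.
  by apply: measurable_fun_limn_esup => m; exact: measurableT_comp.
- by move=> x; apply: (limn_einf_ge (N := 0)) => m _.
- apply: le_trans (fatou mu measurableT mF (fun m x _ => F0 m x)) _.
  apply: limn_einf_le => m.
  have -> : (\int[mu]_x F m x = ((tau m)^-1)%:E * \int[mu]_x (A x * tent x0 kappa x *
    (w x - w (x - (s * tau m) *: delta_mx ord0 i)))%:E)%E.
    rewrite -ge0_integralZl_EFin//.
    + by move=> x _; rewrite lee_fin; exact: (increment_ge0 s1 Tw).
    + exact/measurable_EFinP.
    + by rewrite invr_ge0 ltW.
  have Aoo : (\int[mu]_x (A x * w x)%:E < +oo)%E by rewrite integral_powR_patch.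
  have tinv0 : (0 <= ((tau m)^-1)%:E)%E by rewrite lee_fin invr_ge0 ltW.
  apply: le_trans (lee_wpmul2l tinv0
    (local_estimate oU wg mw w0 p1 s1 rho0 TU Tw (taur m) Aoo)) _ => {Aoo}.
  rewrite muleA -EFinM mulVf ?gt_eqF// mul1e EFinD ge0_muleDl ?lee_fin ?(ltW p0)//.
  have p0E : (0 <= p%:E)%E by rewrite lee_fin ltW.
  by rewrite mul1e; exact: (leeD (lee_wpmul2l p0E AN.1) AN.2).
move=> x L tau1 Ux xk tau10 L0 hL.
have [M hM] : exists M, forall m, (M <= m)%N -> tau m < tau1.
  exists (Num.bound (rho / 2 / tau1)) => m Mm.
  rewrite /tau ltr_pdivrMr// (mulrC tau1) -ltr_pdivrMr//.
  have q0 : 0 <= rho / 2 / tau1 by rewrite divr_ge0 ?(ltW rho20) ?(ltW tau10).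
  apply: lt_le_trans (archi_boundP q0) _.
  by rewrite ler_nat; exact: leq_trans Mm _.
(* The ball is halved so that the cut-off, which tends to 0 at the edge, has a positive lower bound
   on it. *)
have tentx : kappa / 2 <= tent x0 kappa x.
  by rewrite le_max; apply/orP; right; lra.
apply: (limn_einf_ge (N := M)) => m Mm; rewrite /F lee_fin.
rewrite /A patchE mem_set// [leRHS]mulrC -!mulrA ler_wpM2l ?powR_ge0//.
rewrite [leLHS]mulrC ler_pM ?divr_ge0 ?(ltW kappa0)//.
by apply: hL; rewrite tau0 hM.
Qed.

End local_liminf.

Lemma open_sublevel {R : realType} {n : nat} (D : set 'rV[R]_n) (eps : R) :
  D !=set0 -> ~` D !=set0 ->
  open (sublevel D eps).
Proof.
move=> D0 DC0; rewrite (_ : sublevel D eps = signed_dist D @^-1` `]-oo, eps[).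
  apply: open_comp => [x _|]; last exact: interval_open.
  exact: continuous_signed_dist.
by apply/seteqP; split => x /=; rewrite in_itv.
Qed.

Section chart_estimate.
Context {R : realType} {n : nat}.
Local Notation mu := (lebesgue_rV R n.+1).
Variables (D : set 'rV[R]_n.+1) (S : R -> R) (p : R).
Hypotheses (D0 : D !=set0) (DC0 : ~` D !=set0).
Hypotheses (trS : transition_profile S) (p1 : 1 <= p).
Variables (x0 : 'rV[R]_n.+1) (i : 'I_n.+1) (s rho c : R).
Hypotheses (s1 : s ^+ 2 = 1) (rho0 : 0 < rho) (c0 : 0 < c).
Hypothesis chart : forall x t, `|x - x0| < rho -> 0 <= t <= rho ->
  signed_dist D (x + (s * t) *: delta_mx ord0 i) <= signed_dist D x - c * t.
Local Notation kappa := (Num.min 1 (rho / 2)).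

Lemma chart_le x t : `|x - x0| < rho -> 0 <= t <= rho ->
  signed_dist D (x + (s * t) *: delta_mx ord0 i) <= signed_dist D x.
Proof.
move=> xr tr; apply: le_trans (chart xr tr) _.
by rewrite lerBlDr lerDl mulr_ge0 ?(ltW c0)//; case/andP: tr.
Qed.

Lemma chart_ge x t : `|x - x0| < rho / 2 -> 0 <= t <= rho / 2 ->
  signed_dist D x + c * t <= signed_dist D (x - t *: (s *: delta_mx ord0 i)).
Proof.
move=> xr /andP[t0 tr].
have yE : x - t *: (s *: delta_mx ord0 i) + (s * t) *: delta_mx ord0 i = x.
  by apply/rowP => j; rewrite !mxE; ring.
have sn : `|s| = 1 by apply/eqP; rewrite -sqrp_eq1// real_normK ?num_real// s1.
have dn : `|delta_mx ord0 i : 'rV[R]_n.+1| <= 1.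
  by apply: le_trans (norm_le_enorm _) _; rewrite enorm_delta.
have yr : `|x - t *: (s *: delta_mx ord0 i) - x0| < rho.
  rewrite addrAC; apply: le_lt_trans (ler_normB _ _) _.
  rewrite !normrZ sn mul1r ger0_norm//.
  have : t * `|delta_mx ord0 i : 'rV[R]_n.+1| <= t by rewrite ler_piMr.
  by move: xr tr; lra.
have := chart (t := t) yr; rewrite yE => h; rewrite -lerBrDr; apply: h.
by rewrite t0; move: tr; lra.
Qed.

(** Applies the preceding lower limit with L = |grad w| / K and K = 8(n + 1)/c, from the gradient
    bound; the factor 2/kappa compensates the lower bound of the cut-off. Neither constant involves
    eps or v. *)
Lemma chart_estimate (eps : R) (v : 'rV[R]_n.+1 -> R) : 0 < eps ->
  weighted_W1p p (sublevel D eps) (phase_field S D eps) v ->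
  exists G : 'rV[R]_n.+1 -> \bar R, [/\ measurable_fun setT G,
    (forall x, 0 <= G x)%E,
    (\int[mu]_x G x <= (p + 1)%:E *
      weighted_W1p_normp p (sublevel D eps) (phase_field S D eps) v)%E &
    forall x, `|signed_dist D x| < eps -> `|x - x0| < kappa / 2 ->
      ((`|v x| `^ p * enorm (gradient (phase_field S D eps) x))%:E <=
        (8 * n.+1%:R / c * (2 / kappa))%:E * G x)%E].
Proof.
move=> eps0 W1p.
have kappa0 : 0 < kappa by rewrite lt_min ltr01 divr_gt0.
have oU := open_sublevel (eps := eps) D0 DC0.
have mw : measurable_fun setT (phase_field S D eps).
  by apply: continuous_measurable_rV; exact: continuous_phase_field.
have w0 x : 0 <= phase_field S D eps x by exact: phase_field_ge0.
have TU x t : `|x - x0| < rho -> 0 <= t <= rho -> sublevel D eps x ->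
    sublevel D eps (x + (s * t) *: delta_mx ord0 i).
  by move=> xr tr; exact: le_lt_trans (chart_le xr tr).
have Tw x t : `|x - x0| < rho -> 0 <= t <= rho ->
    phase_field S D eps x <= phase_field S D eps (x + (s * t) *: delta_mx ord0 i).
  by move=> xr tr; apply: phase_field_homo => //; exact: chart_le.
have [G [mG G0 GN hG]] := local_liminf oU W1p mw w0 p1 s1 rho0 TU Tw.
exists G; split => // x dx xk {TU Tw w0}.
have xrho : `|x - x0| < rho / 2.
  apply: lt_le_trans xk _; rewrite ler_pdivrMr// ge_min; apply/orP; right.
  by move: rho0; lra.
have rho20 : 0 < rho / 2 by rewrite divr_gt0.
have [tau tau0 hgrad] := gradient_phase_field_le trS eps0 D0 DC0 rho20 c0 dx
  (fun t => chart_ge xrho (t := t)).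
set K := 8 * n.+1%:R / c.
have K0 : 0 < K by rewrite !mulr_gt0 ?invr_gt0.
have Ux : sublevel D eps x by apply: le_lt_trans dx; exact: ler_norm.
have {hG} := hG x (K^-1 * enorm (gradient (phase_field S D eps) x)) tau Ux xk tau0.
have L0 : 0 <= K^-1 * enorm (gradient (phase_field S D eps) x).
  by rewrite mulr_ge0 ?invr_ge0 ?(ltW K0)// enorm_ge0.
move=> /(_ L0) hG.
have h t : 0 < t < tau -> K^-1 * enorm (gradient (phase_field S D eps) x) <=
    (phase_field S D eps x -
     phase_field S D eps (x - (s * t) *: delta_mx ord0 i)) / t.
  by move=> tt; rewrite ler_pdivrMl// (mulrC s) -scalerA; exact: hgrad.
have {hG}/(lee_wpmul2l) := hG h.
have K20 : (0 <= (K * (2 / kappa))%:E)%E.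
  by rewrite lee_fin mulr_ge0 ?(ltW K0)// divr_ge0 ?(ltW kappa0).
move=> /(_ _ K20); apply: le_trans; rewrite -EFinM lee_fin le_eqVlt; apply/orP; left.
apply/eqP; move: (kappa) kappa0 (enorm _) (_ `^ _) => k k0 a b.
by field; rewrite !gt_eqF.
Qed.

End chart_estimate.

(** * Patching the local estimates *)

Section boundary_estimate.
Context {R : realType} {n : nat}.
Local Notation mu := (lebesgue_rV R n.+1).
Variables (D : set 'rV[R]_n.+1) (S : R -> R) (p : R).
Hypotheses (domD : bounded_domain D) (C11D : C11_boundary D).
Hypotheses (trS : transition_profile S) (p1 : 1 <= p).

(** The radius and the constant are fixed before eps and [v], whereas [G] may depend on both.
    Stating it for every z, also off the boundary, lets a choice function on the whole space select
    the pairs. *)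
Lemma boundary_estimate z : exists rC : R * R,
  [/\ 0 <= rC.2, (boundary D z -> 0 < rC.1) &
  forall (eps : R) (v : 'rV[R]_n.+1 -> R), 0 < eps ->
  weighted_W1p p (sublevel D eps) (phase_field S D eps) v ->
  exists G : 'rV[R]_n.+1 -> \bar R, [/\ measurable_fun setT G,
    (forall x, 0 <= G x)%E,
    (\int[mu]_x G x <= rC.2%:E *
      weighted_W1p_normp p (sublevel D eps) (phase_field S D eps) v)%E &
    forall x, `|signed_dist D x| < eps -> `|x - z| < rC.1 ->
      ((`|v x| `^ p * enorm (gradient (phase_field S D eps) x))%:E <= G x)%E]].
Proof.
have [D0 oD _ bD] := domD.
have DC0 := setC_nonempty bD.
have [bz|nbz] := pselect (boundary D z); last first.
  (* Off the boundary the radius 0 makes the pointwise bound vacuous. *)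
  exists (0, 0); split => // eps v _ _; exists (cst 0%E); split => //.
  - by rewrite integral0 mul0e.
  - by move=> x _ /=; rewrite ltNge normr_ge0.
have [i [s [rho [c [s1 rho0 c0 chart]]]]] := boundary_chart oD D0 C11D bz.
set kappa := Num.min 1 (rho / 2).
have kappa0 : 0 < kappa by rewrite lt_min ltr01 divr_gt0.
set K := 8 * n.+1%:R / c * (2 / kappa).
have K0 : 0 <= K by rewrite !mulr_ge0 ?invr_ge0 ?(ltW c0) ?(ltW kappa0).
exists (kappa / 2, K * (p + 1)); split => /=.
- by rewrite mulr_ge0// addr_ge0// (le_trans ler01).
- by move=> _; rewrite divr_gt0.
move=> eps v eps0 W1p.
have [G [mG G0 GN hG]] := chart_estimate D0 DC0 trS p1 s1 rho0 c0 chart eps0 W1p.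
exists (fun x => K%:E * G x)%E; split => //.
- exact: measurable_funeM.
- by move=> x; rewrite mule_ge0// lee_fin.
- by rewrite ge0_integralZl_EFin// (EFinM K) -muleA; apply: lee_wpmul2l GN; rewrite lee_fin.
Qed.

End boundary_estimate.

Theorem theorem4p2 (R : realType) (n : nat) (D : set 'rV[R]_n.+1)
    (domD : bounded_domain D) (C11D : C11_boundary D)
    (S : R -> R) (trS : transition_profile S) (pgS : power_growth S)
    (p : R) (p_ge1 : 1 <= p) :
  exists2 eps_bar : R, 0 < eps_bar &
  forall eps0 : R, 0 < eps0 <= eps_bar ->
  exists2 C : R, 0 < C &
  forall eps : R, 0 < eps < eps0 ->
  forall v : 'rV[R]_n.+1 -> R,
  weighted_W1p p (sublevel D eps) (phase_field S D eps) v ->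
  (\int[lebesgue_rV R n.+1]_(x in sublevel D eps)
      (`|v x| `^ p * enorm (gradient (phase_field S D eps) x))%:E
   <= C%:E *
      weighted_W1p_normp p (sublevel D eps) (phase_field S D eps) v)%E.
Proof.
have [D0 oD _ bD] := domD.
have DC0 := setC_nonempty bD.
have /choice[rC hrC] := boundary_estimate domD C11D trS p_ge1.
(* Half radii cover the boundary; the other halves absorb the distance from a point of the layer to
   the boundary. *)
have [|l lb lcov] := boundary_finite_cover (D := D) (rad := fun z => (rC z).1 / 2) bD.
  by move=> z bz; rewrite divr_gt0//; have [_ /(_ bz)] := hrC z.
(* With eps below every half radius, a point at distance less than eps from a covered boundary point
   stays in the corresponding full ball. *)
exists (\big[Num.min/1]_(y <- l) ((rC y).1 / 2)).
  rewrite big_seq; apply: lt_bigmin => // y yl.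
  by rewrite divr_gt0//; have [_ /(_ (lb _ yl))] := hrC y.
move=> eps0 /andP[_ eps0l].
have C0 y : 0 <= (rC y).2 by have [] := hrC y.
(* The summand 1 makes the constant positive even if the sum is 0. *)
exists (\sum_(y <- l) (rC y).2 + 1).
  by rewrite ltr_wpDl// sumr_ge0.
move=> eps /andP[epsp eps_eps0] v W1p.
have hG y := let: And3 _ _ h := hrC y in h eps v epsp W1p.
have {hrC hG}/choice[G hG] := hG.
set N := weighted_W1p_normp _ _ _ _.
have N0 : (0 <= N)%E.
  apply: integral_ge0 => x _; rewrite lee_fin mulr_ge0 ?phase_field_ge0//.
  by rewrite addr_ge0// powR_ge0.
have G0 y x : (0 <= G y x)%E by have [_ /(_ x)] := hG y.
have mG y : measurable_fun setT (G y) by have [] := hG y.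
have mU : measurable (sublevel D eps).
  exact: open_measurable_rV (open_sublevel (eps := eps) D0 DC0).
apply: (@le_trans _ _ (\int[lebesgue_rV R n.+1]_(x in sublevel D eps)
    \sum_(y <- l) G y x)%E).
  apply: le_lower_integral => x Ux.
    by rewrite lee_fin mulr_ge0 ?powR_ge0 ?enorm_ge0.
  (* Deep inside, the gradient is 0; otherwise |d| < eps, and x lies in the ball of a single index
     y, whose [G y] is one nonnegative term of the sum. *)
  have [dx|dx] := leP (signed_dist D x) (- eps).
    by rewrite (gradient_phase_field_in trS)// mulr0 sume_ge0.
  have {}dx : `|signed_dist D x| < eps by rewrite ltr_norml dx.
  have [z bz xz] := boundary_near oD D0 DC0 dx.
  have [y yl zy] := lcov z bz.
  have [_ _ _ /(_ x dx)] := hG y.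
  have -> : `|x - y| < (rC y).1.
    have := ler_normD (x - z) (z - y); rewrite subrKA.
    have := @ge_bigmin_seq _ _ _ _ 1 y xpredT (fun y => (rC y).1 / 2) yl isT.
    by move: xz zy eps_eps0 eps0l; lra.
  move=> /(_ isT) h; apply: le_trans h _.
  by rewrite (big_rem y)//= leeDl// sume_ge0.
(* The bounds on the functions [G y] concern integrals over the whole space; enlarging the domain is
   harmless as they are nonnegative. *)
apply: (@le_trans _ _ (\int[lebesgue_rV R n.+1]_x \sum_(y <- l) G y x)%E).
  apply: ge0_subset_integral => //; first exact: emeasurable_sum.
  by move=> x _; rewrite sume_ge0.
rewrite ge0_integral_sum//.
apply: (@le_trans _ _ (\sum_(y <- l) (rC y).2%:E * N)%E).
  by apply: lee_sum => y _; have [] := hG y.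
rewrite -ge0_sume_distrl => [|y _]; last by rewrite lee_fin.
by rewrite sumEFin lee_wpmul2r// lee_fin lerDl.
Qed.
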